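(* Let $f\colon\mathbb{R}^d\to\mathbb{R}$ be a CPWL function and $\mathcal{C}$ a polyhedral complex in $\mathbb{R}^d$. If $\mathcal{D}_{\mathcal{C}}(f)$, or equivalently its projection $\pi(\mathcal{D}_{\mathcal{C}}(f))$ where $\pi((g,h))=g$, has a unique vertex, then this vertex corresponds to the unique minimal decomposition within $\mathcal{D}_{\mathcal{C}}(f)$.
   Context: A polyhedral complex $\mathcal{C}$ in $\mathbb{R}^d$ is a finite collection of polyhedra containing $\emptyset$, closed under taking faces, such that any two members intersect in a common face; $\mathcal{C}^d$ denotes the set of $d$-dimensional members. All polyhedral complexes are assumed pure of dimension $d$ and complete (the union of the members is $\mathbb{R}^d$). A function $f\colon\mathbb{R}^d\to\mathbb{R}$ is CPWL (continuous and piecewise linear) if there is such a complex $\mathcal{C}$ with $f$ affine on every member of $\mathcal{C}$; then $f$ and $\mathcal{C}$ are called compatible. The number of pieces of a CPWL function is the smallest possible value of $\#\mathcal{C}^d$ over all compatible complexes $\mathcal{C}$; it is unchanged by adding an affine function. $\mathcal{V}_{\mathcal{C}}$ is the (finite-dimensional) vector space of CPWL functions compatible with $\mathcal{C}$, $\overline{\mathcal{V}}_{\mathcal{C}}=\mathcal{V}_{\mathcal{C}}/\mathrm{Aff}(\mathbb{R}^d)$ its quotient by affine functions, and $\overline{\mathcal{V}}_{\mathcal{C}}^{+}\subseteq\overline{\mathcal{V}}_{\mathcal{C}}$ is the polyhedral cone of classes of convex functions. The decomposition polyhedron is $\mathcal{D}_{\mathcal{C}}(f)=\{(g,h)\mid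 g,h\in\overline{\mathcal{V}}_{\mathcal{C}}^{+},\ f=g-h\}$ (equality modulo affine functions), a polyhedron in $\overline{\mathcal{V}}_{\mathcal{C}}\times\overline{\mathcal{V}}_{\mathcal{C}}$; the projection $\pi((g,h))=g$ restricts to an isomorphism from $\mathcal{D}_{\mathcal{C}}(f)$ onto the polyhedron $\pi(\mathcal{D}_{\mathcal{C}}(f))\subseteq\overline{\mathcal{V}}_{\mathcal{C}}$. A decomposition $(g,h)\in\mathcal{D}_{\mathcal{C}}(f)$ is called minimal if there is no other $(g',h')\in\mathcal{D}_{\mathcal{C}}(f)$ such that $g'$ has at most as many pieces as $g$, $h'$ has at most as many pieces as $h$, and one of the two has strictly fewer pieces. *)

(* Defs.v *)
From HB Require Import structures.
From mathcomp Require Import all_boot all_order all_algebra.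
From mathcomp Require Import finmap all_classical all_reals.
From mathcomp Require Import convex.
Set Implicit Arguments.
Unset Strict Implicit.
Unset Printing Implicit Defensive.
Import Order.TTheory GRing.Theory Num.Theory.
Local Open Scope classical_set_scope.
Local Open Scope ring_scope.
Local Open Scope quotient_scope.

Section Polyhedra.
Context {R : realType} {V : lmodType R}.
Implicit Types (P F : set V) (f : V -> R^o).

Definition polyhedron P : Prop :=
  exists (n : nat) (a : 'I_n -> {linear V -> R^o}) (b : 'I_n -> R),
    P = [set x | forall i, a i x <= b i].

(* [a = 0] shows that P (take [b = 0]) and set0 (take [b = 1]) are faces. *)
Definition is_face F P : Prop :=
  exists (a : {linear V -> R^o}) (b : R),
    (forall x, P x -> a x <= b) /\ F = [set x | P x /\ a x = b].

(* The zero-dimensional faces, identified with their unique point. *)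
Definition vertex P (v : V) : Prop := is_face [set v] P.

Definition aff_independent (n : nat) (p : 'I_n -> V) : Prop :=
  forall c : 'I_n -> R,
    \sum_i c i = 0 -> \sum_i c i *: p i = 0 -> forall i, c i = 0.

(* The empty set has no dimension in this sense, not even when V = 0. *)
Definition has_dim P (k : nat) : Prop :=
  (exists2 p : 'I_k.+1 -> V, aff_independent p & forall i, P (p i)) /\
  ~ (exists2 p : 'I_k.+2 -> V, aff_independent p & forall i, P (p i)).

Definition affine_on P f : Prop :=
  exists (a : {linear V -> R^o}) (b : R), forall x, P x -> f x = a x + b.

End Polyhedra.

Section CPWL.
Context {R : realType} {d : nat}.
Implicit Types (C : set (set 'rV[R]_d)) (f g h : 'rV[R]_d -> R^o).

Definition cells C (k : nat) : set (set 'rV[R]_d) :=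
  [set P | C P /\ has_dim P k].

(* Purity and completeness are part of the definition. *)
Record polyhedral_complex C : Prop := PolyhedralComplex {
  complex_finite : finite_set C;
  complex_polyhedron : forall P, C P -> polyhedron P;
  complex_set0 : C set0;
  complex_face : forall P F, C P -> is_face F P -> C F;
  complex_meet : forall P Q, C P -> C Q ->
    is_face (P `&` Q) P /\ is_face (P `&` Q) Q;
  complex_pure : forall P, C P ->
    (forall Q, C Q -> P `<=` Q -> Q = P) -> has_dim P d;
  complex_complete : \bigcup_(P in C) P = setT
}.

Definition compatible C f : Prop := forall P, C P -> affine_on P f.

(* Continuity need not be required: the cells are finitely many closed sets
   covering the space. *)
Definition cpwl f : Prop :=
  exists2 C, polyhedral_complex C & compatible C f.

Definition num_cells C : nat := #|` fset_set (cells C d)|.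

Definition is_num_pieces f (n : nat) : Prop :=
  (exists C, [/\ polyhedral_complex C, compatible C f & num_cells C = n]) /\
  (forall C, polyhedral_complex C -> compatible C f -> (n <= num_cells C)%N).

(* The junk value 0 is only taken when f is not CPWL. *)
Definition num_pieces f : nat := xget 0%N [set n | is_num_pieces f n].

Definition convex_fun f : Prop := convex_function setT f.

Lemma affine_onD (P : set 'rV[R]_d) (c : R) f g :
  affine_on P f -> affine_on P g -> affine_on P (c *: f + g).
Proof.
move=> [a [b fE]] [a' [b' gE]].
exists (c \*: a \+ a'), (c * b + b') => x Px.
have -> : (c *: f + g) x = c *: f x + g x by [].
by rewrite fE // gE //= scalerDr addrACA.
Qed.

Lemma affine_on0 (P : set 'rV[R]_d) : affine_on P (0 : 'rV[R]_d -> R^o).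
Proof. by exists \0, 0 => x _ /=; rewrite addr0. Qed.

Lemma affine_onS (P Q : set 'rV[R]_d) f :
  P `<=` Q -> affine_on Q f -> affine_on P f.
Proof. by move=> PQ [a [b fE]]; exists a, b => x /PQ /fE. Qed.

Lemma compatible_add_affine C f g :
  affine_on setT g -> compatible C (f + g) <-> compatible C f.
Proof.
move=> affg; split=> compat P CP; last first.
  rewrite -[f]scale1r; apply: affine_onD; first exact: compat.
  by apply: affine_onS affg.
rewrite -(addrK g f) addrC -scaleN1r.
by apply: affine_onD (compat P CP); apply: affine_onS affg.
Qed.

Lemma num_pieces_add_affine f g :
  affine_on setT g -> num_pieces (f + g) = num_pieces f.
Proof.
move=> affg; congr (xget _ _); apply/funext => n; apply/propext.
have cE C := compatible_add_affine C f affg.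
split=> -[[C [? /cE ? ?]] le_n]; split; try by [exists C]; try by
  move=> C' ? /cE; exact: le_n.
Qed.

End CPWL.

Section DecompositionPolyhedron.
Context {R : realType} {d : nat} (C : set (set 'rV[R]_d)).

Definition compatible_pred : {pred 'rV[R]_d -> R^o} :=
  fun f => `[< compatible C f >].

Lemma compatible_submod : submod_closed compatible_pred.
Proof.
split=> [|c f g /asboolP cf /asboolP cg]; apply/asboolP => P CP.
  exact: affine_on0.
by apply: affine_onD; [exact: cf | exact: cg].
Qed.

HB.instance Definition _ :=
  GRing.isSubmodClosed.Build R ('rV[R]_d -> R^o) compatible_pred
    compatible_submod.

Record cpwl_space : Type := CPWLSpace {
  cpwl_fun :> 'rV[R]_d -> R^o;
  cpwl_funP : cpwl_fun \in compatible_pred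
}.

HB.instance Definition _ := [isSub for cpwl_fun].
HB.instance Definition _ := [Choice of cpwl_space by <:].
HB.instance Definition _ := [SubChoice_isSubLmodule of cpwl_space by <:].

Definition affine_pred : {pred cpwl_space} :=
  fun f => `[< affine_on setT (f : 'rV[R]_d -> R^o) >].

Lemma affine_submod : submod_closed affine_pred.
Proof.
split=> [|c f g /asboolP af /asboolP ag]; apply/asboolP.
  exact: affine_on0.
exact: affine_onD.
Qed.

HB.instance Definition _ :=
  GRing.isSubmodClosed.Build R cpwl_space affine_pred affine_submod.

(* The quotient of the space of compatible functions by the affine ones. *)
Definition cpwl_quot : Type := Quotient.quot affine_pred.

HB.instance Definition _ := GRing.Zmodule.on cpwl_quot.

Definition cpwl_class (f : cpwl_space) : cpwl_quot := \pi f.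
Definition cpwl_repr (x : cpwl_quot) : cpwl_space := repr x.

Lemma cpwl_reprK : cancel cpwl_repr cpwl_class.
Proof. exact: reprK. Qed.

Lemma cpwl_class_eq (f g : cpwl_space) :
  cpwl_class f = cpwl_class g <-> f - g \in affine_pred.
Proof. by rewrite Quotient.idealrBE; split => /eqP. Qed.

Lemma cpwl_classD : {morph cpwl_class : f g / f + g}.
Proof. exact: Quotient.pi_add. Qed.

Definition cpwl_scale (c : R) (x : cpwl_quot) : cpwl_quot :=
  cpwl_class (c *: cpwl_repr x).

Lemma cpwl_scale_class c f :
  cpwl_scale c (cpwl_class f) = cpwl_class (c *: f).
Proof.
apply/cpwl_class_eq; rewrite -scalerBr rpredZ //.
by apply/cpwl_class_eq; rewrite cpwl_reprK.
Qed.

Lemma cpwl_scaleA a b x :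
  cpwl_scale a (cpwl_scale b x) = cpwl_scale (a * b) x.
Proof. by rewrite cpwl_scale_class scalerA. Qed.

Lemma cpwl_scale1 : left_id 1 cpwl_scale.
Proof. by move=> x; rewrite /cpwl_scale scale1r cpwl_reprK. Qed.

Lemma cpwl_scaleDr : right_distributive cpwl_scale +%R.
Proof.
move=> c x y; rewrite -(cpwl_reprK x) -(cpwl_reprK y) -cpwl_classD.
by rewrite !cpwl_scale_class scalerDr cpwl_classD.
Qed.

Lemma cpwl_scaleDl x : {morph cpwl_scale^~ x : a b / a + b}.
Proof. by move=> a b; rewrite /cpwl_scale scalerDl cpwl_classD. Qed.

HB.instance Definition _ := GRing.Zmodule_isLmodule.Build R cpwl_quot
  cpwl_scaleA cpwl_scale1 cpwl_scaleDr cpwl_scaleDl.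

Lemma cpwl_class_linear : linear cpwl_class.
Proof. by move=> c f g; rewrite cpwl_classD -cpwl_scale_class. Qed.

HB.instance Definition _ :=
  GRing.isLinear.Build R cpwl_space cpwl_quot _ cpwl_class cpwl_class_linear.

Definition convex_cone : set cpwl_quot :=
  cpwl_class @` [set g : cpwl_space | convex_fun g].

Definition class_num_pieces (x : cpwl_quot) : nat := num_pieces (cpwl_repr x).

Lemma class_num_piecesE (g : cpwl_space) :
  class_num_pieces (cpwl_class g) = num_pieces g.
Proof.
rewrite /class_num_pieces.
have /asboolP aff : cpwl_repr (cpwl_class g) - g \in affine_pred.
  by apply/cpwl_class_eq; rewrite cpwl_reprK.
rewrite -(num_pieces_add_affine (cpwl_fun g) aff); congr num_pieces.
have -> : cpwl_fun (cpwl_repr (cpwl_class g) - g) =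
  (cpwl_repr (cpwl_class g) : _ -> _) - (g : _ -> _) by [].
by rewrite addrC subrK.
Qed.

(* Empty when f is not compatible with C. *)
Definition decomp (f : 'rV[R]_d -> R^o) : set (cpwl_quot * cpwl_quot) :=
  [set gh | [/\ convex_cone gh.1, convex_cone gh.2 &
    exists2 f' : cpwl_space, cpwl_fun f' = f & cpwl_class f' = gh.1 - gh.2]].

Definition decomp_proj (f : 'rV[R]_d -> R^o) : set cpwl_quot :=
  fst @` decomp f.

Definition minimal_decomp (f : 'rV[R]_d -> R^o) (gh : cpwl_quot * cpwl_quot) :
  Prop :=
  decomp f gh /\
  ~ exists gh', [/\ decomp f gh', gh' <> gh,
      (class_num_pieces gh'.1 <= class_num_pieces gh.1)%N,
      (class_num_pieces gh'.2 <= class_num_pieces gh.2)%N &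
      (class_num_pieces gh'.1 < class_num_pieces gh.1)%N \/
      (class_num_pieces gh'.2 < class_num_pieces gh.2)%N].

End DecompositionPolyhedron.

Arguments cpwl_space {R d} C.
Arguments cpwl_quot {R d} C.
Arguments cpwl_class {R d C} f.
Arguments convex_cone {R d} C.
Arguments decomp {R d} C f.
Arguments decomp_proj {R d} C f.
Arguments minimal_decomp {R d} C f gh.

(* Main.v *)
Require Import Defs.
From HB Require Import structures.
From mathcomp Require Import all_boot all_order all_algebra.
From mathcomp Require Import finmap all_classical all_reals.
From mathcomp Require Import convex interval_inference ring lra.
Set Implicit Arguments.
Unset Strict Implicit.
Unset Printing Implicit Defensive.
Import Order.TTheory GRing.Theory Num.Theory.
Local Open Scope classical_set_scope.
Local Open Scope ring_scope.

(** Why the theorem is true.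

    Write [K] for the cone of classes of convex functions and [phi] for the
    class of [f]. A decomposition is determined by its first component, which
    ranges over [P], the set of the [x] with [x] and [x - phi] in [K]
    ([decomp_graph]); this gives the equivalence of the two hypotheses
    ([vertex_graph]).

    The cone [K] is cut out by finitely many linear inequalities [0 <= psi i x]
    ([convex_cone_halfspaces]): a compatible function is convex if and only if
    on each full-dimensional cell [Q] its affine piece on [Q] dominates its
    affine pieces on the other cells, and nonnegativity of an affine function on
    a polyhedron can be tested on finitely many points and recession directions
    ([polyhedron_tests]). So [P] is given by the inequalities
    [max 0 (psi i phi) <= psi i x]. As [K] contains no line, each [psi i] is
    minimised over [P] at some vertex; if there is only one vertex [g], it
    minimises all of them, that is, [x - g] is in [K] for every [x] in [P]
    ([decomp_proj_unique_vertex]). Every decomposition is therefore of the form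
    [(g + k, h + k)] with [k] in [K], where [(g, h)] is the vertex.

    Adding a convex function to a convex function does not decrease the number
    of pieces, since a complex compatible with the sum is compatible with both
    summands ([compatible_convex_summand]). This makes [(g, h)] minimal. Let
    [(g + k, h + k)] be another minimal decomposition; then the numbers of
    pieces of [g + k] and [g] agree, and so do those of [h + k] and [h]. A
    complex with the least number of cells for [g + k] then also has the least
    number of cells for [g], so its full-dimensional cells are the regions of
    linearity of the convex function [g] ([affine_extension_inj],
    [cell_region]) and [k] is affine on each of them. Thus [k] can only bend
    where [g] bends, and [g - e k] is still convex for some [e > 0]
    ([subtract_convex]). The same holds for [h], hence
    [(g - e k, h - e k)] is a decomposition for some [e > 0]; then
    [- e k] is in [K] like [k], and [k = 0]. *)

(** * Pointed polyhedra *)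

Section FinitelyManyConstraints.
Context {R : realFieldType}.

Lemma small_step (I : finType) (a b : I -> R) :
  (forall i, 0 <= a i) -> (forall i, a i = 0 -> b i <= 0) ->
  exists s, [/\ 0 < s, s <= 1 & forall i, s * b i <= a i].
Proof.
move=> a_ge0 ab0; exists (\big[Order.min/1]_(i | 0 < b i) (a i / b i)); split.
- apply/bigmin_gtP; split=> // i bi_gt0; rewrite divr_gt0 // lt0r a_ge0 andbT.
  by apply: contraTneq bi_gt0 => /ab0; rewrite leNgt.
- by apply/bigmin_leP; left.
move=> i; have [bi_gt0|bi_le0] := ltP 0 (b i).
  by rewrite -ler_pdivlMr //; apply: bigmin_le_cond.
apply: le_trans (a_ge0 i); apply: mulr_ge0_le0 => //; apply/bigmin_geP.
by split=> // j bj_gt0; rewrite divr_ge0 // ltW.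
Qed.

(** The longest step that keeps all of the slacks [a] nonnegative, taken in a
    direction in which some slack decreases, exhausts a slack. *)
Lemma longest_step (I : finType) (a b : I -> R) (l : I) :
  (forall i, 0 <= a i) -> (forall i, a i = 0 -> b i <= 0) -> 0 < b l ->
  exists s, [/\ 0 < s, forall i, s * b i <= a i &
    exists2 i, 0 < b i & s * b i = a i].
Proof.
move=> a_ge0 ab0 bl_gt0.
have a_gt0 i : 0 < b i -> 0 < a i.
  move=> bi_gt0; rewrite lt0r a_ge0 andbT.
  by apply: contraTneq bi_gt0 => /ab0; rewrite leNgt.
case: (@arg_minP _ _ _ l (fun i => 0 < b i) (fun i => a i / b i) bl_gt0).
move=> i bi_gt0 min_i; exists (a i / b i); split.
- by rewrite divr_gt0 ?a_gt0.
- move=> j; have [bj_gt0|bj_le0] := ltP 0 (b j).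
    by rewrite -ler_pdivlMr // min_i.
  apply: le_trans (a_ge0 j); apply: mulr_ge0_le0 => //.
  by rewrite divr_ge0 // ltW.
- by exists i; rewrite // divfK // gt_eqF.
Qed.

Lemma slope_le (a b x y : R) :
  (forall s, 0 <= s -> x + s * a <= y + s * b) -> a <= b.
Proof.
move=> le_line; rewrite leNgt; apply/negP => ab.
have ab_gt0 : 0 < a - b by rewrite subr_gt0.
have s_ge0 : 0 <= (`|y - x| + 1) / (a - b).
  by apply: divr_ge0; [exact: addr_ge0 | exact: ltW].
have := le_line _ s_ge0; set s := _ / _.
have sE : s * (a - b) = `|y - x| + 1 by rewrite divfK // gt_eqF.
by have := ler_norm (y - x); move: sE; rewrite mulrBr; lra.
Qed.

End FinitelyManyConstraints.

Lemma linear_funE {R : pzRingType} {V : lmodType R} (f : V -> R^o) :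
  linear f -> exists F : {linear V -> R^o}, F =1 f.
Proof.
move=> lin_f; pose m := GRing.isLinear.Build R V R^o *:%R f lin_f.
by exists (HB.pack_for {linear V -> R^o} f m).
Qed.

Section PolyhedraByInequalities.
Context {R : realFieldType} {V : lmodType R} {I : finType}.
Context (psi : I -> {linear V -> R^o}) (beta : I -> R).
Hypothesis pointed : forall x, (forall i, psi i x = 0) -> x = 0.

Let feasible x := forall i, beta i <= psi i x.
Let tight x : {set I} := [set i | psi i x == beta i].

(** As long as the tight constraints at [x] do not determine [x], there is a
    direction that preserves them and does not increase [psi i]; it leads to a
    point where one more constraint is tight. *)
Lemma exists_basic_point (i : I) (x : V) : feasible x ->
  exists v, [/\ feasible v, psi i v <= psi i x &
    forall y, (forall j, psi j v = beta j -> psi j y = 0) -> y = 0].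
Proof.
have [n] := ubnP #|~: tight x|; elim: n x => // n IHn x lt_n feas_x.
have [basic|] := pselect (forall y,
    (forall j, psi j x = beta j -> psi j y = 0) -> y = 0).
  by exists x.
move/existsNP => [r /not_implyP [r_tight /eqP r_neq0]].
wlog [l r_l r_i] : r r_tight r_neq0 /
    exists2 l, psi l r < 0 & psi i r <= 0.
  (* Either [r] or [- r] is such a direction. *)
  move=> wlog_r.
  have [l /eqP r_l] : exists l, psi l r <> 0.
    apply/existsNP => r0; case/eqP: r_neq0; exact: pointed.
  have Nr_tight j : psi j x = beta j -> psi j (- r) = 0.
    by rewrite linearN => /r_tight ->; rewrite oppr0.
  have Nr_neq0 : - r != 0 by rewrite oppr_eq0.
  case: (ltgtP (psi i r) 0) => r_i.
  - by apply: (wlog_r r) => //; exists i => //; exact: ltW.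
  - apply: (wlog_r (- r)) => //; exists i; rewrite linearN oppr_cp0 //.
    exact: ltW.
  - case: (ltgtP (psi l r) 0) r_l => // r_l _.
      by apply: (wlog_r r) => //; exists l; rewrite ?r_i.
    by apply: (wlog_r (- r)) => //; exists l; rewrite linearN ?oppr_cp0 ?r_i.
have [|||s [s_gt0 s_le [m m_lt0 m_tight]]] :=
    @longest_step _ I (fun j => psi j x - beta j) (fun j => - psi j r) l.
- by move=> j; rewrite subr_ge0.
- by move=> j /eqP; rewrite subr_eq0 => /eqP /r_tight ->; rewrite oppr0.
- by rewrite oppr_gt0.
have psiE j : psi j (x + s *: r) = psi j x + s * psi j r.
  by rewrite linearD linearZ.
have [||v [feas_v v_i basic]] := IHn (x + s *: r).
- rewrite -ltnS; apply: leq_trans lt_n; rewrite ltnS.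
  apply: proper_card; apply/properP; split.
    apply/fintype.subsetP => j; rewrite !inE psiE.
    by apply: contra => /eqP x_j; rewrite (r_tight j x_j) mulr0 addr0 x_j.
  move: m_tight m_lt0; rewrite oppr_gt0 mulrN => m_tight m_lt0.
  exists m; rewrite !inE ?psiE.
    by apply: contraTneq m_lt0 => /r_tight ->; rewrite ltxx.
  by rewrite negbK; apply/eqP; move: m_tight; lra.
- by move=> j; rewrite psiE; have := s_le j; lra.
exists v; split=> //; apply: le_trans v_i _.
by rewrite psiE gerDl mulr_ge0_le0 // ltW.
Qed.

End PolyhedraByInequalities.

Section UniqueVertex.
Context {R : realType} {V : lmodType R} {I : finType}.
Context (psi : I -> {linear V -> R^o}) (beta : I -> R).
Hypothesis pointed : forall x, (forall i, psi i x = 0) -> x = 0.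

Let P := [set x | forall i, beta i <= psi i x].

(** The sum of the tight constraints is minimised at the point only. *)
Lemma basic_point_vertex (v : V) : P v ->
  (forall y, (forall i, psi i v = beta i -> psi i y = 0) -> y = 0) ->
  vertex P v.
Proof.
move=> Pv basic.
have [a aE] : exists a : {linear V -> R^o},
    a =1 (fun x => - \sum_(i | psi i v == beta i) psi i x).
  apply: linear_funE => c x y; rewrite scalerN -opprD; congr (- _).
  by rewrite scaler_sumr -big_split; apply: eq_bigr => i _; rewrite linearP.
exists a, (- \sum_(i | psi i v == beta i) beta i); split=> [x Px|].
  by rewrite aE lerN2; apply: ler_sum => i _; apply: Px.
apply/seteqP; split=> [x /= ->|x /= [Px]].
  by split=> //; rewrite aE; congr (- _); apply: eq_bigr => i /eqP.
rewrite aE => /oppr_inj /eqP; rewrite -subr_eq0 -sumrB psumr_eq0; last first.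
  by move=> i _; rewrite subr_ge0.
move=> /allP tight; apply/eqP; rewrite -subr_eq0; apply/eqP; apply: basic.
move=> i vi; have /implyP := tight i (mem_index_enum i).
by rewrite vi linearB /= vi; move/(_ (eqxx _))/eqP.
Qed.

(** Each of the defining functionals is minimised at a vertex. *)
Lemma unique_vertex_le (v : V) : unique (vertex P) v ->
  forall x, P x -> forall i, psi i v <= psi i x.
Proof.
move=> [_ v_unique] x Px i.
have [w [Pw w_i basic]] := exists_basic_point pointed i Px.
by rewrite (v_unique w) //; apply: basic_point_vertex.
Qed.

End UniqueVertex.

Lemma vertex_mem (R : realType) (V : lmodType R) (P : set V) v :
  vertex P v -> P v.
Proof. by move=> [a [b [_ /seteqP [/(_ v erefl) []]]]]. Qed.

Lemma vertex_graph (R : realType) (V : lmodType R) (P : set V)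
    (D : set (V * V)%type) phi :
  (forall p, D p <-> P p.1 /\ p.2 = p.1 - phi) ->
  forall p, vertex D p <-> vertex P p.1 /\ p.2 = p.1 - phi.
Proof.
move=> DE [x y] /=; split=> [vD|[[a [b [a_le Px]]] yE]].
  have [Px yE] := (DE _).1 (vertex_mem vD); rewrite /= in Px yE; split=> //.
  have [a [b [a_le Dp]]] := vD.
  have [l lE] : exists l : {linear V -> R^o}, l =1 (fun z => a (z, z)).
    by apply: linear_funE => c z t; rewrite -linearP.
  have aE z : a (z, z - phi) = l z - a (0, phi).
    by rewrite lE -linearB; congr (a _); congr pair; rewrite /= subr0.
  exists l, (b + a (0, phi)); split=> [z Pz|].
    by rewrite -lerBlDr -aE; apply: a_le; apply/DE.
  apply/seteqP; split=> [z /= ->|z /= [Pz lz]].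
    have [_ axy] : [set p | D p /\ a p = b] (x, y) by rewrite -Dp.
    by split=> //; rewrite -axy yE aE subrK.
  have : [set (x, y)] (z, z - phi).
    by rewrite Dp /=; split; [apply/DE | rewrite aE lz addrK].
  by case.
exists (a \o fst), b; split=> [p /DE [Pp _]|]; first exact: a_le.
have PaE z : P z /\ a z = b <-> z = x.
  by have /seteqP [sub1 sub2] := Px; split=> [/sub2 //|->]; apply: (sub1 x).
apply/seteqP; split=> [p /= ->|[z t] /= [/DE [/= Pz tE] az]].
  by have [Pz az] := (PaE x).2 erefl; split=> //; apply/DE.
have zx : z = x by apply/PaE.
by rewrite tE zx -yE.
Qed.

(** * Testing nonnegativity on a polyhedral cone *)

Section DoubleDescription.
Context {R : realFieldType} {W : lmodType R}.
Implicit Types (K : set W) (G : seq W).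

Definition convex_cone_set K : Prop :=
  (forall x y, K x -> K y -> K (x + y)) /\
  (forall c x, 0 <= c -> K x -> K (c *: x)).

(** By duality, [G] and [K] generate the same closed convex cone; only the
    dual form is used, and it avoids sums over [G]. *)
Definition tests_cone G K : Prop := {in G, forall g, K g} /\
  forall u : {linear W -> R^o},
    {in G, forall g, 0 <= u g} -> forall x, K x -> 0 <= u x.

(** One step of the double description method, dualised: if [u] is nonnegative
    on the new family, then some nonnegative multiple [lambda] of [a] can be
    subtracted from [u] so as to make it nonnegative on the old family. That the
    bounds on [lambda] are compatible is what nonnegativity of [u] on the mixed
    elements of the new family says. *)
Lemma tests_cone_halfspace G K (a : {linear W -> R^o}) :
  convex_cone_set K -> tests_cone G K ->
  exists G', tests_cone G' [set x | K x /\ 0 <= a x].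
Proof.
move=> [KD KZ] [GK test_G].
exists ([seq g <- G | 0 <= a g] ++
  [seq a gg.1 *: gg.2 - a gg.2 *: gg.1 |
     gg <- [seq (g, g') | g <- G, g' <- G] & (0 < a gg.1) && (a gg.2 < 0)]).
split=> [x|u u_ge0].
  rewrite mem_cat mem_filter => /orP [/andP[ax /GK]//|].
  move=> /mapP [[g g']]; rewrite mem_filter /= => /andP [/andP [ag ag']].
  move=> /allpairsP [[h h'] /= [hG h'G [gE g'E]]] ->; subst h h'.
  split.
    rewrite -scaleNr; apply: KD; apply: KZ; rewrite ?oppr_ge0 ?ltW //.
      exact: GK.
    exact: GK.
  by rewrite linearB !linearZ /= /GRing.scale /= mulrN [a g' * _]mulrC subrr.
have u_pos g : g \in G -> 0 <= a g -> 0 <= u g.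
  by move=> gG ag; apply: u_ge0; rewrite mem_cat mem_filter ag gG.
have u_mix g g' : g \in G -> g' \in G -> 0 < a g -> a g' < 0 ->
    0 <= a g * u g' - a g' * u g.
  move=> gG g'G ag ag'.
  have -> : a g * u g' - a g' * u g = u (a g *: g' - a g' *: g).
    by rewrite linearB !linearZ.
  apply: u_ge0; rewrite mem_cat; apply/orP; right.
  apply/mapP; exists (g, g') => //; rewrite mem_filter /= ag ag' /=.
  by apply/allpairsP; exists (g, g').
pose lambda := \big[Order.max/0]_(i < size G | a G`_i < 0) (u G`_i / a G`_i).
have lambda_ge0 : 0 <= lambda by apply/bigmax_geP; left.
have [v vE] : exists v : {linear W -> R^o}, v =1 (fun x => u x - lambda * a x).
  apply: linear_funE => c x y; rewrite !linearP /= /GRing.scale /=; ring.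
move=> x [Kx ax]; suff: 0 <= v x.
  by rewrite vE subr_ge0; apply: le_trans; rewrite mulr_ge0.
apply: test_G Kx => g gG; rewrite vE subr_ge0.
have [ag|ag|ag] := ltgtP 0 (a g).
- rewrite -ler_pdivlMr //; apply/bigmax_leP; split=> [|i ai].
    by rewrite divr_ge0 ?u_pos // ltW.
  rewrite ler_pdivlMr // mulrAC ler_ndivrMr //.
  by have := u_mix _ _ gG (mem_nth 0 (ltn_ord i)) ag ai; lra.
- rewrite -ler_ndivrMr //; apply/bigmax_geP; right.
  have g_lt : (index g G < size G)%N by rewrite index_mem.
  by exists (Ordinal g_lt); rewrite /= nth_index.
- by rewrite -ag mulr0 u_pos // -ag.
Qed.

Lemma tests_cone_halfspaces (I : finType) G K (a : I -> {linear W -> R^o}) :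
  convex_cone_set K -> tests_cone G K ->
  exists G', tests_cone G' [set x | K x /\ forall i, 0 <= a i x].
Proof.
move=> coneK test_G.
suff /(_ (enum I)) [G' test_G'] : forall s : seq I,
    exists G', tests_cone G' [set x | K x /\ {in s, forall i, 0 <= a i x}].
  exists G'; congr (tests_cone _ _) : test_G'; apply/seteqP.
  by split=> x [Kx ax]; split=> // i; rewrite ?ax ?mem_enum.
elim=> [|i s [G' test_G']].
  by exists G; rewrite (_ : [set _ | _] = K) //; apply/seteqP; split=> x // [].
have [|G'' test_G''] := tests_cone_halfspace (a i) _ test_G'; last first.
  exists G''; congr (tests_cone _ _) : test_G''; apply/seteqP; split=> x /=.
    move=> [[Kx ax] aix]; split=> // j.
    by rewrite inE => /predU1P [->//|/ax].
  move=> [Kx ax]; split; last by rewrite ax ?mem_head.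
  by split=> // j js; rewrite ax // inE js orbT.
case: coneK => KD KZ; split=> [x y [Kx ax] [Ky ay]|c x c_ge0 [Kx ax]] /=.
  split=> [|j js]; first exact: KD.
  by rewrite linearD addr_ge0 ?ax ?ay.
split=> [|j js]; first exact: KZ.
by rewrite linearZ mulr_ge0 ?ax.
Qed.

End DoubleDescription.

(** * Affine functions and generic points *)

Section AffineFunctions.
Context {R : realType} {V : lmodType R}.
Implicit Types (S : set V) (u v : V -> R^o).

Definition segment_closed S : Prop := forall x y t,
  S x -> S y -> 0 <= t -> t <= 1 -> S (x + t *: (y - x)).

(** In finite dimension, the affine hull of [S] is the whole space. *)
Definition affinely_spanning S : Prop := forall u,
  affine_on setT u -> (forall x, S x -> u x = 0) -> forall x, u x = 0.

Lemma affine_funE u : affine_on setT u ->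
  exists (a : {linear V -> R^o}) (b : R), forall x, u x = a x + b.
Proof. by move=> [a [b uE]]; exists a, b => x; apply: uE. Qed.

Lemma affine_funB u v : affine_on setT u -> affine_on setT v ->
  affine_on setT (fun x => u x - v x).
Proof.
move=> [a [b uE]] [a' [b' vE]].
by exists (a \- a'), (b - b') => x _ /=; rewrite uE // vE // opprD addrACA.
Qed.

Lemma affine_line u x y t : affine_on setT u ->
  u (x + t *: (y - x)) = u x + t * (u y - u x).
Proof.
move=> /affine_funE [a [b uE]]; rewrite !uE linearD linearZ /= linearB /=.
by rewrite /GRing.scale /=; ring.
Qed.

Lemma affine_ray u x y t : affine_on setT u ->
  u (x + t *: y) = u x + t * (u y - u 0).
Proof.
move=> /affine_funE [a [b uE]]; rewrite !uE linearD linearZ /= linear0.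
by rewrite /GRing.scale /=; ring.
Qed.

Lemma polyhedron_finType (T : finType) (l : T -> {linear V -> R^o})
    (c : T -> R) :
  polyhedron [set x | forall t, l t x <= c t].
Proof.
exists #|T|, (fun i => l (enum_val i)), (fun i => c (enum_val i)).
apply/seteqP; split=> x Px t //.
by have := Px (enum_rank t); rewrite enum_rankK.
Qed.

Lemma polyhedron_segment_closed S : polyhedron S -> segment_closed S.
Proof.
move=> [n [a [b ->]]] x y t /= Sx Sy t_ge0 t_le1 i.
have -> : x + t *: (y - x) = (1 - t) *: x + t *: y.
  by rewrite scalerBr scalerBl scale1r addrA addrAC.
rewrite linearD !linearZ /= /GRing.scale /=.
have -> : b i = (1 - t) * b i + t * b i by ring.
by rewrite lerD // ler_wpM2l // subr_ge0.
Qed.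

(** A convex set is not covered by finitely many hyperplanes that do not
    contain it: moving slightly towards a point off the next hyperplane does
    not reach the hyperplanes already avoided. *)
Lemma generic_point (I : finType) S (u : I -> V -> R^o) (x0 : V) :
  segment_closed S -> S x0 -> (forall i, affine_on setT (u i)) ->
  (forall i, exists2 x, S x & u i x != 0) ->
  exists2 x, S x & forall i, u i x != 0.
Proof.
move=> convS Sx0 aff_u u_neq0.
suff /(_ (enum I)) [x Sx x_s] : forall s : seq I,
    exists2 x, S x & {in s, forall i, u i x != 0}.
  by exists x => // i; rewrite x_s ?mem_enum.
elim=> [|i s [x Sx x_s]]; first by exists x0.
have [y Sy y_i] := u_neq0 i.
have [ux0|ux_neq0] := eqVneq (u i x) 0; last first.
  by exists x => // j; rewrite inE => /predU1P [->|/x_s].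
have [||t [t_gt0 t_le1 t_small]] := @small_step _ I (fun j => `|u j x| / 2)
    (fun j => if u j x == 0 then 0 else `|u j y - u j x|).
- by move=> j; rewrite divr_ge0.
- by move=> j /eqP; rewrite mulf_eq0 normr_eq0 invr_eq0 pnatr_eq0 orbF => ->.
exists (x + t *: (y - x)) => [|j]; first by apply: convS => //; exact: ltW.
rewrite inE affine_line // => /predU1P [->|js].
  by rewrite ux0 add0r subr0 mulf_neq0 // gt_eqF.
have := t_small j; rewrite (negbTE (x_s j js)).
rewrite -[t in t * _]gtr0_norm // -normrM.
move: (t * _) => D D_small; apply: contraTneq (x_s j js) => /eqP.
rewrite addr_eq0 => /eqP ujx; move: D_small; rewrite ujx normrN => D_small.
rewrite oppr_eq0 negbK -normr_eq0 eq_le normr_ge0 andbT.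
by move: D_small; have := normr_ge0 D; lra.
Qed.

(** An algebraic interior point exists: at a generic point of [S], all of the
    nontrivial constraints are slack. *)
Lemma polyhedron_core S : polyhedron S -> affinely_spanning S -> S !=set0 ->
  exists2 p, S p & forall w, exists2 s, 0 < s & S (p + s *: w).
Proof.
move=> polyS spanS [x0 Sx0]; have convS := polyhedron_segment_closed polyS.
have [n [a [b SE]]] := polyS.
pose u (i : 'I_n) x : R^o := a i x - b i.
have aff_u i : affine_on setT (u i) by exists (a i), (- b i).
pose T := {i : 'I_n | `[< exists x, u i x != 0 >]}.
have [||p Sp u_p] := @generic_point T S (fun i => u (val i)) x0 convS Sx0.
- by move=> i; apply: aff_u.
- case=> i /= /asboolP [x ui_x]; apply: contrapT => /forall2NP ui0.
  suff u0 y : u i y = 0 by rewrite u0 eqxx in ui_x.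
  apply: spanS => // z Sz; have [//|/negP] := ui0 z.
  by rewrite negbK => /eqP.
exists p => // w.
have [||s [s_gt0 _ s_small]] := @small_step _ 'I_n (fun i => b i - a i p)
    (fun i => a i w).
- by move=> i; rewrite subr_ge0; move: Sp; rewrite SE; apply.
- move=> i /eqP; rewrite subr_eq0 => /eqP biE.
  have [nz|/forallNP u0] := pselect (exists x, u i x != 0).
    have := u_p (exist _ i (asboolT nz)).
    by rewrite /u /= biE subrr eqxx.
  have /negP := u0 w; have /negP := u0 0.
  rewrite !negbK /u linear0 sub0r oppr_eq0 => /eqP ->.
  by rewrite subr0 => /eqP ->.
exists s => //; rewrite SE => i.
by rewrite linearD linearZ /= -lerBrDl s_small.
Qed.

End AffineFunctions.

(** * Full-dimensional sets and homogenisation *)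

Section EuclideanSpace.
Context {R : realType} {d : nat}.
Local Notation E := 'rV[R]_d.
Implicit Types (P Q S : set E) (u : E -> R^o).

Lemma row_linearE (a : {linear E -> R^o}) x :
  a x = \sum_j x ord0 j * a (delta_mx ord0 j).
Proof.
rewrite [in LHS](row_sum_delta x) linear_sum; apply: eq_bigr => j _.
by rewrite linearZ.
Qed.

(** Affine independence is linear independence after homogenisation. *)
Lemma aff_independent_rank n (p : 'I_n -> E) :
  aff_independent p <->
  row_free (\matrix_(i < n) row_mx (1%:M : 'M[R]_1) (p i)).
Proof.
have mulE (c : 'rV[R]_n) :
    c *m \matrix_(i < n) row_mx (1%:M : 'M[R]_1) (p i) =
    row_mx (\sum_i c ord0 i)%:M (\sum_i c ord0 i *: p i).
  rewrite mulmx_sum_row.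
  rewrite (eq_bigr (fun i => row_mx (c ord0 i)%:M (c ord0 i *: p i))).
    elim/big_rec3: _ => [|i x y z _ ->]; first by rewrite raddf0 row_mx0.
    by rewrite add_row_mx raddfD.
  by move=> i _; rewrite rowK scale_row_mx scale_scalar_mx mulr1.
split=> [ind|free c c0 cp i].
  apply: inj_row_free => c; rewrite mulE -row_mx0 => /eq_row_mx [c0 cp].
  apply/rowP => i; rewrite mxE; apply: ind => //.
  by have /matrixP/(_ ord0 ord0) := c0; rewrite !mxE eqxx mulr1n.
suff /eqP/rowP/(_ i) : \row_i c i == 0 by rewrite !mxE.
rewrite -(mulmx_free_eq0 _ free) mulE -row_mx0.
under eq_bigr do rewrite mxE; under [X in row_mx _ X]eq_bigr do rewrite mxE.
by rewrite c0 cp raddf0.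
Qed.

(** The values of an affine function at [d + 1] affinely independent points
    determine it, by invertibility of the matrix of the homogenised points. *)
Lemma has_dim_spanning P : has_dim P d -> affinely_spanning P.
Proof.
move=> [[p /aff_independent_rank free Pp] _] u /affine_funE [a [b uE]] u0 x.
pose M : 'M[R]_(1 + d) := \matrix_(i < d.+1) row_mx (1%:M : 'M[R]_1) (p i).
have M_unit : M \in unitmx by rewrite -row_free_unit.
pose U : 'cV[R]_(1 + d) := col_mx b%:M (\col_j a (delta_mx ord0 j)).
have evalE y : row_mx (1%:M : 'M[R]_1) y *m U = (u y)%:M.
  rewrite mul_row_col mul1mx uE; apply/matrixP => i j.
  rewrite !ord1 !mxE eqxx !mulr1n addrC row_linearE; congr (_ + _).
  by apply: eq_bigr => k _; rewrite !mxE.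
have U0 : U = 0.
  rewrite -[U]mul1mx -(mulVmx M_unit) -mulmxA.
  suff -> : M *m U = 0 by rewrite mulmx0.
  apply/row_matrixP => i; rewrite row_mul rowK evalE u0 //.
  by rewrite raddf0 row0.
have := evalE x; rewrite U0 mulmx0 => /matrixP /(_ ord0 ord0).
by rewrite !mxE eqxx mulr1n.
Qed.

Lemma has_dim_subset P Q : P `<=` Q -> has_dim P d -> has_dim Q d.
Proof.
move=> PQ [[p ind Pp] _]; split; first by exists p => // i; apply: PQ.
move=> [q /aff_independent_rank /eqP rank_q _].
by have := rank_leq_col (\matrix_i row_mx (1%:M : 'M[R]_1) (q i));
  rewrite rank_q ltnn.
Qed.

Lemma has_dim_neq0 P k : has_dim P k -> P !=set0.
Proof. by move=> [[p _ Pp] _]; exists (p ord0). Qed.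

(** For [u x = a x + b], this is the linear functional [a x + b t] of the
    pair [w = (x, t)]. *)
Definition homogenize u (w : E * R^o) : R^o := u w.1 + (w.2 - 1) * u 0.

Lemma homogenize_linear u : affine_on setT u ->
  exists U : {linear (E * R^o)%type -> R^o}, U =1 homogenize u.
Proof.
move=> /affine_funE [a [b uE]].
apply: linear_funE => c [x s] [y t]; rewrite /homogenize /= !uE linearP linear0.
by rewrite /GRing.scale /=; ring.
Qed.

Lemma homogenizeB u v w :
  homogenize (fun x => u x - v x) w = homogenize u w - homogenize v w.
Proof. by rewrite /homogenize; ring. Qed.

Lemma homogenizeZ u w c : affine_on setT u ->
  homogenize u (c *: w) = c * homogenize u w.
Proof. by move=> /homogenize_linear [U UE]; rewrite -!UE linearZ. Qed.

Lemma homogenize_ray u (w : E * R^o) z s : affine_on setT u -> w.2 = 0 ->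
  u (z + s *: w.1) = u z + s * homogenize u w.
Proof.
by move=> aff_u w0; rewrite affine_ray // /homogenize w0 sub0r mulN1r.
Qed.

Lemma homogenize_point u (w : E * R^o) : affine_on setT u -> 0 < w.2 ->
  homogenize u w = w.2 * u (w.2^-1 *: w.1).
Proof.
move=> aff_u w_gt0.
have -> : u (w.2^-1 *: w.1) = homogenize u (w.2^-1 *: w).
  by rewrite /homogenize /= [_ *: w.2]mulVf ?gt_eqF // subrr mul0r addr0.
by rewrite homogenizeZ // mulVKf ?gt_eqF.
Qed.

(** The closed cone over the copy of [Q] at height one: the positive multiples
    of its points, and the recession directions of [Q] at height zero. *)
Definition homogenization Q : set (E * R^o) := [set g |
  (0 < g.2 /\ Q (g.2^-1 *: g.1)) \/
  (g.2 = 0 /\ forall x s, Q x -> 0 <= s -> Q (x + s *: g.1))].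

(** The homogenisation is a polyhedral cone, so that nonnegativity on it can be
    tested on a finite family. *)
Lemma polyhedron_tests Q : polyhedron Q -> Q !=set0 ->
  exists2 G : seq (E * R^o)%type, {in G, forall g, homogenization Q g} &
    forall u, affine_on setT u ->
      ((forall x, Q x -> 0 <= u x) <-> {in G, forall g, 0 <= homogenize u g}).
Proof.
move=> [n [a [b QE]]] [z Qz].
pose K0 := [set w : E * R^o | 0 <= w.2].
have coneK0 : convex_cone_set K0.
  by split=> [x y|c x]; rewrite /K0 /=; [exact: addr_ge0 | exact: mulr_ge0].
have [G0 test_G0] : exists G0, tests_cone G0 K0.
  exists ((0, 1) :: [seq (s *: delta_mx ord0 i, 0) |
                      s <- [:: 1; -1], i <- enum 'I_d]).
  split=> [g|u u_ge0 [x t] /= t_ge0].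
    rewrite inE => /predU1P [->|]; first by rewrite /K0 /= ler01.
    by move=> /allpairsP [[s i] [_ _ ->]]; rewrite /K0 /=.
  have u0 i : u (delta_mx ord0 i, 0) = 0.
    apply/eqP; rewrite eq_le; apply/andP; split; last first.
      apply: u_ge0; rewrite inE; apply/orP; right; apply/allpairsP.
      by exists (1, i); rewrite /= mem_enum scale1r inE eqxx.
    rewrite -oppr_ge0 -linearN; apply: u_ge0; rewrite inE; apply/orP; right.
    apply/allpairsP; exists (-1, i).
    rewrite /= mem_enum scaleN1r !inE eqxx orbT; split=> //.
    by congr pair; rewrite oppr0.
  have [a' a'E] : exists a' : {linear E -> R^o}, a' =1 (fun y => u (y, 0)).
    apply: linear_funE => c y y'; rewrite -linearP; congr (u _).
    by congr pair; rewrite /= scaler0 addr0.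
  have -> : (x, t) = (x, 0) + t *: (0, 1).
    by congr pair; rewrite /= ?scaler0 ?addr0 // add0r /GRing.scale /= mulr1.
  rewrite linearD -a'E row_linearE big1 => [|i _]; last first.
    by rewrite a'E u0 mulr0.
  by rewrite add0r linearZ mulr_ge0 // u_ge0 // mem_head.
have /choice [l lE] : forall i, exists l : {linear (E * R^o)%type -> R^o},
    forall w, l w = w.2 * b i - a i w.1.
  move=> i; apply: linear_funE => c [x s] [y t] /=.
  by rewrite linearP /GRing.scale /=; ring.
have [G [GK test_G]] := tests_cone_halfspaces l coneK0 test_G0.
have pos g : g \in G -> 0 < g.2 -> Q (g.2^-1 *: g.1).
  move=> /GK [_ l_ge0] g_gt0; rewrite QE => i.
  rewrite linearZ /= /GRing.scale /= ler_pdivrMl // -subr_ge0.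
  by have := l_ge0 i; rewrite lE.
have ray g x s : g \in G -> Q x -> 0 <= s -> g.2 = 0 -> Q (x + s *: g.1).
  move=> /GK [_ l_ge0]; rewrite QE => Qx s_ge0 g0 i.
  rewrite linearD linearZ /= /GRing.scale /=.
  have := l_ge0 i; rewrite lE g0 mul0r sub0r oppr_ge0 => ag.
  by apply: le_trans (Qx i); rewrite gerDl mulr_ge0_le0.
have GE g : g \in G -> homogenization Q g.
  move=> gG; have [g_ge0 _] := GK g gG; move: g_ge0; rewrite /K0 /= le_eqVlt.
  move=> /predU1P [/esym g0|g_gt0]; last by left; split=> //; apply: pos.
  by right; split=> // x s Qx s_ge0; apply: ray.
exists G => // u aff_u.
split=> [u_ge0 g gG|u_ge0 x Qx]; last first.
  have [U UE] := homogenize_linear aff_u.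
  have : 0 <= U (x, 1).
    apply: test_G => [g /u_ge0|]; first by rewrite UE.
    split=> [|i]; first exact: ler01.
    by rewrite lE mul1r subr_ge0; move: Qx; rewrite QE; apply.
  by rewrite UE /homogenize /= subrr mul0r addr0.
case: (GE g gG) => [[g_gt0 Qg]|[g0 Qray]]; last first.
  apply: (slope_le (x := 0) (y := u z)) => s s_ge0.
  by rewrite mulr0 add0r -homogenize_ray // u_ge0 //; apply: Qray.
by rewrite homogenize_point // mulr_ge0 ?u_ge0 // ltW.
Qed.

End EuclideanSpace.

(** * Cells and affine pieces *)

Section Cells.
Context {R : realType} {d : nat}.
Local Notation E := 'rV[R]_d.
Implicit Types (P Q S : set E) (u v g h : E -> R^o) (C : set (set E)).

Lemma cells_finite C : polyhedral_complex C -> finite_set (cells C d).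
Proof. by move=> hC; apply: sub_finite_set (complex_finite hC) => P []. Qed.

Lemma cells_index C : polyhedral_complex C ->
  exists (T : finType) (cell : T -> set E), [/\ injective cell,
    forall t, cells C d (cell t),
    forall P, cells C d P -> exists t, cell t = P & #|T| = num_cells C].
Proof.
move=> hC; pose X := fset_set (cells C d).
have XE P : (P \in X) = (P \in cells C d).
  by rewrite in_fset_set //; exact: cells_finite.
exists X, val; split=> [|t|P cell_P|]; first exact: val_inj.
- by have := valP t; rewrite XE inE.
- have XP : P \in X by rewrite XE inE.
  by exists [` XP]%fset.
- by rewrite -cardfE.
Qed.

(** By finiteness, every member lies in a maximal one. *)
Lemma cell_superset C P : polyhedral_complex C -> C P ->
  exists2 Q, cells C d Q & P `<=` Q.
Proof.
move=> hC.
have finS S : finite_set [set Q | C Q /\ S `<=` Q].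
  by apply: sub_finite_set (complex_finite hC) => Q [].
have [n] := ubnP #|` fset_set [set Q | C Q /\ P `<=` Q]|.
elim: n P => // n IHn P lt_n CP.
have [max_P|] := pselect (forall Q, C Q -> P `<=` Q -> Q = P).
  by exists P => //; split=> //; apply: complex_pure max_P.
move=> /existsNP [Q /not_implyP [CQ /not_implyP [PQ QP]]].
have [|S cell_S QS] := IHn Q _ CQ; last by exists S => // x /PQ /QS.
rewrite -ltnS; apply: leq_trans lt_n; rewrite ltnS; apply: fproper_ltn_card.
rewrite fproperEneq; apply/andP; split; last first.
  by rewrite -fset_set_sub // => S [CS QS]; split=> // x /PQ /QS.
apply/eqP => /(fset_set_inj (finS Q) (finS P)) /seteqP [_ sub_PQ].
have [|_ QsubP] := sub_PQ P; first by split.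
by apply: QP; apply/seteqP.
Qed.

Lemma cells_cover C x : polyhedral_complex C -> exists2 Q, cells C d Q & Q x.
Proof.
move=> hC; have : (\bigcup_(P in C) P) x by rewrite complex_complete.
move=> [P CP Px]; have [Q cell_Q PQ] := cell_superset hC CP.
by exists Q => //; apply: PQ.
Qed.

Lemma cell_polyhedron C P :
  polyhedral_complex C -> cells C d P -> polyhedron P.
Proof. by move=> hC [CP _]; apply: complex_polyhedron CP. Qed.

Lemma cell_spanning C P : cells C d P -> affinely_spanning P.
Proof. by move=> [_ /has_dim_spanning]. Qed.

Lemma cell_neq0 C P : cells C d P -> P !=set0.
Proof. by move=> [_ /has_dim_neq0]. Qed.

Lemma compatible_cells C h : polyhedral_complex C ->
  (forall P, cells C d P -> affine_on P h) -> compatible C h.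
Proof.
move=> hC aff_h P CP; have [Q cell_Q PQ] := cell_superset hC CP.
exact: affine_onS (aff_h Q cell_Q).
Qed.

Lemma affine_funD c u v : affine_on setT u -> affine_on setT v ->
  affine_on setT (fun x => c * u x + v x : R^o).
Proof. exact: affine_onD. Qed.

Lemma eq_affine_fun P u v : affinely_spanning P ->
  affine_on setT u -> affine_on setT v -> (forall x, P x -> u x = v x) -> u = v.
Proof.
move=> spanP aff_u aff_v uv; apply/funext => x; apply/eqP.
rewrite -subr_eq0; apply/eqP.
apply: (spanP (fun x => u x - v x)) => [|y Py]; first exact: affine_funB.
by rewrite uv ?subrr.
Qed.

(** The default value is only taken when [h] is not affine on [P]. *)
Definition affine_extension P h : E -> R^o :=
  xget (0 : E -> R^o) [set u | affine_on setT u /\ forall x, P x -> u x = h x].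

Lemma affine_extensionP P h : affine_on P h ->
  affine_on setT (affine_extension P h) /\
  forall x, P x -> affine_extension P h x = h x.
Proof.
move=> [a [b hE]]; rewrite /affine_extension; case: xgetP => [u _ //|none].
case: (none (fun x => a x + b)); split=> [|x Px]; first by exists a, b.
by rewrite hE.
Qed.

Lemma affine_extension_unique P h u : affinely_spanning P ->
  affine_on setT u -> (forall x, P x -> u x = h x) -> affine_extension P h = u.
Proof.
move=> spanP aff_u uh; have aff_h : affine_on P h.
  by have [a [b uE]] := aff_u; exists a, b => x Px; rewrite -uh // uE.
have [aff_v vh] := affine_extensionP aff_h.
by apply: eq_affine_fun spanP _ _ _ => // x Px; rewrite vh ?uh.
Qed.

Lemma affine_extension_affine C P h : compatible C h -> cells C d P ->
  affine_on setT (affine_extension P h).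
Proof. by move=> comp_h [/comp_h /affine_extensionP []]. Qed.

Lemma affine_extensionE C P h x : compatible C h -> cells C d P -> P x ->
  affine_extension P h x = h x.
Proof. by move=> comp_h [/comp_h /affine_extensionP [_]] + _; apply. Qed.

Lemma affine_extension_linear C P c g h : compatible C g -> compatible C h ->
  cells C d P -> affine_extension P (c *: g + h) =
    (fun x => c * affine_extension P g x + affine_extension P h x : R^o).
Proof.
move=> comp_g comp_h cell_P.
apply: affine_extension_unique => [||x Px]; first exact: cell_spanning cell_P.
  by apply: affine_funD; apply: affine_extension_affine cell_P.
by rewrite !(affine_extensionE _ cell_P).
Qed.

End Cells.

(** * Convexity as finitely many linear inequalities *)

Section ConvexityTests.
Context {R : realType} {d : nat}.
Local Notation E := 'rV[R]_d.
Implicit Types (P Q S : set E) (u v h : E -> R^o) (C : set (set E)).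

Lemma convex_funP h : convex_fun h <-> forall x y t, 0 <= t -> t <= 1 ->
  h (x + t *: (y - x)) <= h x + t * (h y - h x).
Proof.
have lineE (x y : E) t : x + t *: (y - x) = t *: y + (1 - t) *: x.
  by rewrite scalerBr scalerBl scale1r addrA addrAC addrC.
have lineR (a b t : R) : a + t * (b - a) = t * b + (1 - t) * a by ring.
split=> [cvx x y t t_ge0 t_le1|cvx t x y _ _].
  have := cvx (Itv01 t_ge0 t_le1) y x; rewrite !inE => /(_ Logic.I Logic.I).
  by rewrite lineE lineR.
have := cvx y x t%:num; rewrite ge0 le1 => /(_ isT isT).
by rewrite lineE lineR.
Qed.

Lemma convex_funD u v : convex_fun u -> convex_fun v -> convex_fun (u + v).
Proof.
move=> /convex_funP cvx_u /convex_funP cvx_v.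
apply/convex_funP => x y t t_ge0 t_le1.
have addE z : (u + v) z = u z + v z by [].
have := cvx_u x y t t_ge0 t_le1; have := cvx_v x y t t_ge0 t_le1.
by rewrite !addE; lra.
Qed.

Lemma convex_funZ c u : 0 <= c -> convex_fun u -> convex_fun (c *: u).
Proof.
move=> c_ge0 /convex_funP cvx_u; apply/convex_funP => x y t t_ge0 t_le1.
have scaleE z : (c *: u) z = c * u z by [].
have := ler_wpM2l c_ge0 (cvx_u x y t t_ge0 t_le1); rewrite !scaleE.
by congr (_ <= _); ring.
Qed.

Lemma affine_convex_fun u : affine_on setT u -> convex_fun u.
Proof.
by move=> aff_u; apply/convex_funP => x y t _ _; rewrite affine_line.
Qed.

(** If [h] were below one of its affine pieces at [x], then convexity would fail
    on the segment that joins [x] to [q] through an interior point [p] of the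
    piece, where [q] is a point of the piece slightly beyond [p]. *)
Lemma affine_extension_le C P h x : polyhedral_complex C -> cells C d P ->
  compatible C h -> convex_fun h -> affine_extension P h x <= h x.
Proof.
move=> hC cell_P comp_h /convex_funP cvx.
have aff_u := affine_extension_affine comp_h cell_P.
have uE y := @affine_extensionE _ _ _ _ _ y comp_h cell_P.
set u := affine_extension P h in aff_u uE *.
have [p Pp core] := polyhedron_core (cell_polyhedron hC cell_P)
  (cell_spanning cell_P) (cell_neq0 cell_P).
have [s s_gt0 Pq] := core (p - x); set q := p + _ in Pq.
have s1 : 1 + s != 0 by rewrite gt_eqF ?addr_gt0.
have pE : p = q + (1 + s)^-1 * s *: (x - q).
  rewrite /q.
  have -> : x - (p + s *: (p - x)) = (1 + s) *: (x - p).
    by rewrite opprD addrA scalerDl scale1r -scalerN opprB.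
  by rewrite scalerA mulrAC mulVf // mul1r -[x - p]opprB scalerN addrK.
have t_gt0 : 0 < (1 + s)^-1 * s by rewrite mulr_gt0 ?invr_gt0 ?addr_gt0.
have t_le1 : (1 + s)^-1 * s <= 1.
  by rewrite mulrC ler_pdivrMr ?addr_gt0 // mul1r lerDr.
have := cvx q x _ (ltW t_gt0) t_le1; rewrite -pE -uE // -(uE q) //.
rewrite [in u p]pE affine_line // lerD2l ler_pM2l // lerD2r; exact.
Qed.

(** Under this hypothesis [h] is the maximum of its affine pieces. *)
Lemma convex_fun_max C h : polyhedral_complex C -> compatible C h ->
  (forall P Q x, cells C d P -> cells C d Q -> Q x ->
    affine_extension P h x <= affine_extension Q h x) ->
  convex_fun h.
Proof.
move=> hC comp_h le_h; apply/convex_funP => x y t t_ge0 t_le1.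
have [P cell_P Pz] := cells_cover (x + t *: (y - x)) hC.
rewrite -(affine_extensionE comp_h cell_P) // affine_line; last first.
  exact: affine_extension_affine cell_P.
have u_le z : affine_extension P h z <= h z.
  have [Q cell_Q Qz] := cells_cover z hC.
  by rewrite -(affine_extensionE comp_h cell_Q) //; apply: le_h.
have lineR (a b : R) : a + t * (b - a) = (1 - t) * a + t * b by ring.
by rewrite !lineR lerD ?ler_wpM2l ?subr_ge0.
Qed.

(** A function is convex when its affine piece on each cell [Q] dominates the
    other ones on [Q]; for each pair of cells, this is a finite test. *)
Lemma convex_tests C : polyhedral_complex C ->
  exists (I : finType) (P Q : I -> set E) (w : I -> (E * R^o)%type),
  [/\ forall i, cells C d (P i), forall i, cells C d (Q i),
    forall i, homogenization (Q i) (w i) &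
    forall h, compatible C h -> (convex_fun h <-> forall i,
      homogenize (affine_extension (P i) h) (w i) <=
      homogenize (affine_extension (Q i) h) (w i))].
Proof.
move=> hC; have [T [cell [_ cellP cell_ex _]]] := cells_index hC.
have /choice [G GP] : forall t, exists G : seq (E * R^o)%type,
    {in G, forall w, homogenization (cell t) w} /\
    forall u, affine_on setT u -> ((forall x, cell t x -> 0 <= u x) <->
      {in G, forall w, 0 <= homogenize u w}).
  move=> t; have poly_t := cell_polyhedron hC (cellP t).
  by have [G ? ?] := polyhedron_tests poly_t (cell_neq0 (cellP t)); exists G.
pose J (pq : T * T) := 'I_(size (G pq.2)).
pose I := {pq : T * T & J pq}.
pose w (i : I) : E * R^o := nth (0, 0) (G (tag i).2) (tagged i : J (tag i)).
exists I, (fun i => cell (tag i).1), (fun i => cell (tag i).2), w.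
split=> // [i|h comp_h]; first by apply: (GP _).1; rewrite mem_nth.
have test_le p q :
    (forall x, cell q x ->
       affine_extension (cell p) h x <= affine_extension (cell q) h x) <->
    {in G q, forall w, homogenize (affine_extension (cell p) h) w <=
                       homogenize (affine_extension (cell q) h) w}.
  have [le_test test_le] := (GP q).2 _ (affine_funB
    (affine_extension_affine comp_h (cellP q))
    (affine_extension_affine comp_h (cellP p))).
  split=> [le_u e eG|le_g x Qx].
    rewrite -subr_ge0 -homogenizeB; apply: le_test eG => x Qx.
    by rewrite subr_ge0 le_u.
  rewrite -subr_ge0; apply: test_le Qx => e eG.
  by rewrite homogenizeB subr_ge0 le_g.
split=> [cvx [[p q] j] /=|le_h].
  apply: (test_le p q).1; last by rewrite mem_nth.
  move=> x qx; rewrite (affine_extensionE comp_h (cellP q)) //.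
  exact: affine_extension_le (cellP p) comp_h cvx.
apply: (convex_fun_max hC comp_h) => _ _ x /cell_ex [p <-] /cell_ex [q <-].
apply: (test_le p q).2 => e eG.
have j_lt : (index e (G q) < size (G q))%N by rewrite index_mem.
have := le_h (@Tagged _ (p, q) J (Ordinal j_lt)).
by rewrite /w /= nth_index.
Qed.

End ConvexityTests.

(** * The complex of regions of a maximum of affine functions *)

Section MaximumOfAffineFunctions.
Context {R : realType} {d : nat} {I : finType}.
Local Notation E := 'rV[R]_d.
Context (u : I -> E -> R^o) (g : E -> R^o).
Hypothesis aff_u : forall i, affine_on setT (u i).
Hypothesis u_le : forall i x, u i x <= g x.
Hypothesis u_max : forall x, exists i, u i x = g x.
Implicit Types (J : {set I}) (F S : set E).

Let region J : set E := [set x | forall i, i \in J -> u i x = g x].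

Let regions : set (set E) :=
  [set S | S = set0 \/ exists2 J, J != finset.set0 & S = region J].

Let set0_face S : is_face set0 S.
Proof.
exists \0, 1; split=> [x _|]; first exact: ler01.
by apply/seteqP; split=> // x [_ /= /esym/eqP]; rewrite oner_eq0.
Qed.

Let region_le J i x : i \in J -> region J x -> forall j, u j x <= u i x.
Proof. by move=> iJ Jx j; rewrite (Jx i iJ). Qed.

Let region_polyhedron J : J != finset.set0 -> polyhedron (region J).
Proof.
move=> /set0Pn [i0 i0J].
have /choice [a /choice [b uE]] := fun i => affine_funE (aff_u i).
pose T := ({i | i \in J} * I)%type.
rewrite (_ : region J = [set x | forall t : T,
    (a t.2 \- a (val t.1)) x <= b (val t.1) - b t.2]).
  exact: polyhedron_finType.
apply/seteqP; split=> [x Jx [[i iJ] j] /=|x /= Jx i iJ].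
  by have := region_le iJ Jx j; rewrite !uE; lra.
have [j ujx] := u_max x; apply/eqP; rewrite eq_le u_le -ujx.
by have := Jx (exist _ i iJ, j); rewrite /= !uE; lra.
Qed.

(** On [region J], where the functions of [J] are maximal, the sum of those of
    [J'] is bounded by a multiple of one of those of [J], with equality exactly
    on [region J']. *)
Let region_meet J J' : J != finset.set0 ->
  is_face (region J `&` region J') (region J).
Proof.
move=> /set0Pn [i0 i0J].
have /choice [a /choice [b uE]] := fun i => affine_funE (aff_u i).
have [l lE] : exists l : {linear E -> R^o},
    forall x, l x = \sum_(j in J') (a j x - a i0 x).
  apply: linear_funE => c x y; rewrite scaler_sumr -big_split.
  by apply: eq_bigr => j _; rewrite !linearP /GRing.scale /=; ring.
exists l, (\sum_(j in J') (b i0 - b j)).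
have l_le x j : region J x -> 0 <= b i0 - b j - (a j x - a i0 x).
  by move=> Jx; have := region_le i0J Jx j; rewrite !uE; lra.
split=> [x Jx|].
  by rewrite lE -subr_ge0 -sumrB; apply: sumr_ge0 => j _; exact: l_le.
apply/seteqP; split=> x [Jx]; last first.
  rewrite lE => /eqP; rewrite eq_sym -subr_eq0 -sumrB psumr_eq0; last first.
    by move=> j _; apply: l_le.
  move=> /allP tight; split=> // j jJ'.
  have /implyP := tight j (mem_index_enum j).
  by move=> /(_ jJ') /eqP; have := Jx _ i0J; rewrite !uE; lra.
move=> J'x; split=> //; rewrite lE; apply: eq_bigr => j jJ'.
by have := Jx _ i0J; have := J'x _ jJ'; rewrite !uE; lra.
Qed.

(** A nonempty face is the region of the set [J'] of the functions that are
    maximal on the whole of it: a point [z] of the face at which no other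
    function is maximal is a relative interior point of [region J'], and a
    linear functional that is maximised over [region J] at [z] is constant on
    [region J']. *)
Let face_region J F : J != finset.set0 -> is_face F (region J) -> regions F.
Proof.
move=> J_neq0 [l [c [l_le FE]]].
have [->|/set0P [x0 Fx0]] := eqVneq F set0; first by left.
pose J' : {set I} := [set i | `[< forall x, F x -> u i x = g x >]]%SET.
have JJ' i : i \in J -> i \in J'.
  move=> iJ; rewrite inE; apply/asboolP => x; rewrite FE => -[Jx _].
  exact: Jx.
have [i0 i0J] : exists i0, i0 \in J by apply/set0Pn.
have F_max x : F x -> g x = u i0 x by rewrite FE => -[Jx _]; rewrite Jx.
pose T := {i | i \notin J'}.
have [||||z Fz z_slack] :=
    @generic_point _ _ T F (fun i x => u (val i) x - u i0 x) x0.
- have convJ := polyhedron_segment_closed (region_polyhedron J_neq0).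
  move=> x y t Fx Fy t_ge0 t_le1; move: Fx Fy; rewrite FE.
  move=> -[Jx lx] [Jy ly]; split; first exact: convJ Jx Jy t_ge0 t_le1.
  by rewrite linearD linearZ linearB /= lx ly subrr scaler0 addr0.
- by [].
- by move=> i; apply: affine_funB.
- move=> [i /=]; rewrite inE => /asboolPn /existsNP [x /not_implyP [Fx uix]].
  by exists x => //; rewrite subr_eq0 -F_max //; apply/eqP.
right; exists J'; first by apply/set0Pn; exists i0; apply: JJ'.
apply/seteqP; split=> [x Fx i|y J'y]; first by rewrite inE => /asboolP; apply.
have [Jz lz] : region J z /\ l z = c by move: Fz; rewrite FE.
have Jy : region J y by move=> i /JJ'; apply: J'y.
have [||s [s_gt0 _ s_small]] := @small_step _ T
    (fun i => u i0 z - u (val i) z)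
    (fun i => (u (val i) z - u i0 z) - (u (val i) y - u i0 y)).
- by move=> i; rewrite subr_ge0 (Jz i0).
- by move=> i /eqP; rewrite subr_eq0 eq_sym -subr_eq0 (negbTE (z_slack i)).
(* A point beyond [z] on the ray from [y] that still lies in [region J]. *)
pose w := y + (1 + s) *: (z - y).
have uw i : u i w = u i y + (1 + s) * (u i z - u i y) by apply: affine_line.
have u_w i : u i w <= u i0 w.
  have [iJ'|iJ'] := boolP (i \in J').
    have zi : u i z = g z by move: iJ'; rewrite inE => /asboolP /(_ z Fz).
    by rewrite !uw (J'y i iJ') (J'y i0 (JJ' _ i0J)) zi (Jz i0).
  by have := s_small (exist _ i iJ'); rewrite /= !uw; lra.
have Jw : region J w.
  move=> i iJ; have [j ujw] := u_max w.
  have gw : g w = u i0 w by apply/eqP; rewrite eq_le u_le -ujw u_w.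
  by rewrite gw !uw (Jy i iJ) (Jy i0 i0J) (Jz i iJ) (Jz i0 i0J).
rewrite FE; split=> //; apply/eqP; rewrite eq_le l_le //=.
have := l_le w Jw; rewrite linearD linearZ linearB /= lz /GRing.scale /=.
move=> lw; have : s * (c - l y) <= 0 by move: lw; rewrite mulrDl mul1r; lra.
by rewrite pmulr_rle0 // subr_le0.
Qed.

(** The regions of two or more functions are not full-dimensional, because
    distinct affine functions do not agree on a full-dimensional set. *)
Lemma max_affine_complex : injective u ->
  (forall i, has_dim [set x | u i x = g x] d) ->
  exists K, [/\ polyhedral_complex K, compatible K g & (num_cells K <= #|I|)%N].
Proof.
move=> inj_u dim_u.
have region1 i : region [set i]%SET = [set x | u i x = g x].
  apply/seteqP; split=> [x /(_ i)|x /= uix j]; first by rewrite inE; apply.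
  by rewrite inE => /eqP ->.
have regions1 i : regions (region [set i]%SET).
  by right; exists [set i]%SET => //; apply/set0Pn; exists i; rewrite inE.
have complex_regions : polyhedral_complex regions.
  split.
  - apply: (@sub_finite_set _ _ (set0 |` range region)); last first.
      by rewrite finite_setU; split; [exact: finite_set1 | exact: finite_image].
    by move=> S [->|[J _ ->]]; [left | right; exists J].
  - move=> P [->|[J J_neq0 ->]]; last exact: region_polyhedron.
    rewrite (_ : set0 =
        [set x | forall t : unit, (\0 : {linear E -> R^o}) x <= -1]).
      exact: (@polyhedron_finType _ _ unit (fun=> \0) (fun=> -1)).
    by apply/seteqP; split=> // x /(_ tt) /=; rewrite oppr_ge0 ler10.
  - by left.
  - move=> P F [->|[J J_neq0 ->]]; last exact: face_region.
    by move=> [l [c [_ ->]]]; left; apply/seteqP; split=> // x [].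
  - move=> P Q [->|[J J_neq0 ->]].
      by rewrite set0I; split; apply: set0_face.
    move=> [->|[J' J'_neq0 ->]].
      by rewrite setI0; split; apply: set0_face.
    by split; [apply: region_meet | rewrite setIC; apply: region_meet].
  - move=> P regP max_P; suff [i Pi] : exists i, P `<=` region [set i]%SET.
      by rewrite -(max_P _ (regions1 i) Pi) region1; apply: dim_u.
    case: regP => [->|[J /set0Pn [i iJ] ->]].
      by have [i _] := u_max 0; exists i.
    by exists i => x Jx j; rewrite inE => /eqP ->; apply: Jx.
  - apply/seteqP; split=> // x _; have [i uix] := u_max x.
    by exists (region [set i]%SET); [exact: regions1 | rewrite region1].
exists regions; split=> //.
  move=> P [->|[J /set0Pn [i iJ] ->]]; first by exists \0, 0.
  have [a [b uE]] := affine_funE (aff_u i).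
  by exists a, b => x Jx; rewrite -uE Jx.
rewrite /num_cells -(size_codom (fun i => region [set i]%SET)).
apply: uniq_leq_size (fset_uniq _) _ => S.
rewrite in_fset_set ?inE; last exact: cells_finite.
move=> -[[->|[J /set0Pn [i iJ] ->]] dim_S].
  by have [] := has_dim_neq0 dim_S.
apply/codomP; exists i; congr region; apply/eqP.
rewrite finset.eqEsubset finset.sub1set iJ andbT.
apply/fintype.subsetP => j jJ; rewrite inE; apply/eqP; apply: inj_u.
apply: eq_affine_fun (has_dim_spanning dim_S) _ _ _ => // x Jx.
by rewrite !Jx.
Qed.

End MaximumOfAffineFunctions.

(** * The number of pieces of a sum of convex functions *)

Section NumberOfPieces.
Context {R : realType} {d : nat}.
Local Notation E := 'rV[R]_d.
Implicit Types (P Q S : set E) (u g h k : E -> R^o) (C K : set (set E)).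

Lemma num_piecesP h : cpwl h -> is_num_pieces h (num_pieces h).
Proof.
move=> [C hC comp_h]; rewrite /num_pieces; case: xgetP => [n _ //|none].
have ex_n : exists n, `[< exists C, [/\ polyhedral_complex C, compatible C h &
    num_cells C = n] >].
  by exists (num_cells C); apply/asboolP; exists C.
case: (ex_minnP ex_n) => n /asboolP n_pieces min_n.
case: (none n); split=> // K hK comp_K; apply: min_n.
by apply/asboolP; exists K.
Qed.

(** Let the sum be [U] on a cell [P] of [K]. At a generic point of [P], which
    lies in some cell [Q] of [C], the functions [U] and the sum of the affine
    pieces of [g] and [k] on [Q] agree, hence they are equal. As [g] and [k] lie
    above these pieces and have the same sum on [P], they coincide with them. *)
Lemma compatible_convex_summand C K g k :
  polyhedral_complex C -> polyhedral_complex K ->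
  compatible C g -> compatible C k -> convex_fun g -> convex_fun k ->
  compatible K (g + k) -> compatible K g.
Proof.
move=> hC hK comp_g comp_k cvx_g cvx_k comp_gk.
apply: compatible_cells => // P cell_P.
have [T [cell [_ cellP cell_ex _]]] := cells_index hC.
pose v t x : R^o := 1 * affine_extension (cell t) g x +
  affine_extension (cell t) k x - affine_extension P (g + k) x.
have aff_v t : affine_on setT (v t).
  apply: affine_funB; last exact: affine_extension_affine cell_P.
  by apply: affine_funD; apply: affine_extension_affine (cellP t).
pose T' := {t | `[< exists2 x, P x & v t x != 0 >]}.
have [x0 Px0] := cell_neq0 cell_P.
have [||p Pp v_p] := @generic_point _ _ T' P (fun t => v (val t)) x0
  (polyhedron_segment_closed (cell_polyhedron hK cell_P)) Px0.
- by move=> t; apply: aff_v.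
- by move=> [t /= /asboolP].
have [Q /cell_ex [t <-] tp] := cells_cover p hC.
have v0 x : P x -> v t x = 0.
  move=> Px; apply/eqP/negPn/negP => vx_neq0.
  have T't : `[< exists2 x, P x & v t x != 0 >] by apply/asboolP; exists x.
  have /negP := v_p (exist _ t T't); apply; rewrite /= /v mul1r.
  rewrite (affine_extensionE comp_g (cellP t)) //.
  rewrite (affine_extensionE comp_k (cellP t)) //.
  by rewrite (affine_extensionE comp_gk cell_P) // subrr.
have [a [b gE]] := affine_funE (affine_extension_affine comp_g (cellP t)).
exists a, b => x Px; rewrite -gE; apply/eqP; rewrite eq_le.
rewrite (affine_extension_le x hC (cellP t)) // andbT.
have := affine_extension_le x hC (cellP t) comp_k cvx_k.
have := v0 x Px; rewrite /v (affine_extensionE comp_gk cell_P) //.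
have -> : (g + k) x = g x + k x by [].
by lra.
Qed.

(** Otherwise the complex of regions of linearity of [g] would have fewer
    full-dimensional cells than [C]. *)
Lemma affine_extension_inj C g : polyhedral_complex C -> compatible C g ->
  convex_fun g -> (num_cells C <= num_pieces g)%N ->
  forall P Q, cells C d P -> cells C d Q ->
    affine_extension P g = affine_extension Q g -> P = Q.
Proof.
move=> hC comp_g cvx_g min_C.
have [T [cell [_ cellP cell_ex card_T]]] := cells_index hC.
pose ext t : E -> R^o := affine_extension (cell t) g.
pose s := undup (codom ext); pose u (i : seq_sub s) : E -> R^o := val i.
have uP i : exists t, u i = ext t.
  by have := valP i; rewrite mem_undup => /codomP.
have [||||i|K [hK comp_K le_K]] := @max_affine_complex _ _ _ u g.
- by move=> i; have [t ->] := uP i; apply: affine_extension_affine (cellP t).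
- move=> i x; have [t ->] := uP i.
  exact: affine_extension_le (cellP t) comp_g cvx_g.
- move=> x; have [P /cell_ex [t <-] tx] := cells_cover x hC.
  have s_t : ext t \in s by rewrite mem_undup codom_f.
  exists (SeqSub s_t); rewrite /u /= /ext.
  exact: affine_extensionE (cellP t) tx.
- exact: val_inj.
- have [t ->] := uP i; apply: has_dim_subset (cellP t).2 => x tx /=.
  exact: affine_extensionE (cellP t) tx.
have /injectiveP inj : injectiveb ext.
  rewrite /injectiveb /dinjectiveb -[_ (image_mem _ _)]negbK.
  rewrite -ltn_size_undup -leqNgt size_codom card_T; apply: leq_trans min_C _.
  apply: leq_trans ((num_piecesP _).2 K hK comp_K) _; first by exists C.
  by rewrite (leq_trans le_K) // card_seq_sub // undup_uniq.
by move=> _ _ /cell_ex [p <-] /cell_ex [q <-] /inj ->.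
Qed.

(** Suppose that [g] is given at [x] by its affine piece on [P], but that [x]
    violates a constraint of [P]. The points of this kind form a convex set that
    contains small segments from [x] to all points of [P]; a generic one of them
    lies in a cell with another affine piece, which is absurd. *)
Lemma cell_region C g P x : polyhedral_complex C -> compatible C g ->
  convex_fun g ->
  (forall P Q, cells C d P -> cells C d Q ->
    affine_extension P g = affine_extension Q g -> P = Q) ->
  cells C d P -> g x = affine_extension P g x -> P x.
Proof.
move=> hC comp_g cvx_g inj cell_P gx.
have [T [cell [_ cellP cell_ex _]]] := cells_index hC.
have aff_u := affine_extension_affine comp_g cell_P.
have uE y := @affine_extensionE _ _ _ _ _ y comp_g cell_P.
have u_le y := affine_extension_le y hC cell_P comp_g cvx_g.
set u := affine_extension P g in aff_u uE u_le gx.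
apply: contrapT => NPx.
have [n [a [b PE]]] := cell_polyhedron hC cell_P.
have [i x_i] : exists i, b i < a i x.
  apply: contrapT => /forallNP a_le; apply: NPx; rewrite PE => i.
  by rewrite leNgt; apply/negP.
pose S : set E := [set z | g z = u z /\ b i < a i z].
have region y z t : g y = u y -> g z = u z -> 0 <= t -> t <= 1 ->
    g (y + t *: (z - y)) = u (y + t *: (z - y)).
  move=> gy gz t_ge0 t_le1; apply/eqP; rewrite eq_le u_le andbT.
  by rewrite (affine_line _ _ _ aff_u) -gy -gz; apply: (convex_funP g).1.
have convS : segment_closed S.
  move=> y z t [gy ay] [gz az] t_ge0 t_le1; split; first exact: region.
  rewrite linearD linearZ linearB /= /GRing.scale /=.
  have -> : a i y + t * (a i z - a i y) = (1 - t) * a i y + t * a i z by ring.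
  have -> : b i = (1 - t) * b i + t * b i by ring.
  have [->|t_neq0] := eqVneq t 0.
    by rewrite !mul0r subr0 !mul1r !addr0.
  apply: ler_ltD; first by rewrite ler_wpM2l ?subr_ge0 // ltW.
  by rewrite ltr_pM2l // lt0r t_neq0.
pose T' := {t | cell t != P}.
pose v (t : T') z : R^o := affine_extension (cell (val t)) g z - u z.
have aff_v t : affine_on setT (v t).
  by apply: affine_funB aff_u; apply: affine_extension_affine (cellP (val t)).
have [|||y [gy ay] v_y] := @generic_point _ _ T' S v x convS; try by [].
- move=> t; apply: contrapT => /forall2NP v0.
  have {}v0 z : S z -> v t z = 0.
    by move=> Sz; have [//|/negP] := v0 z; rewrite negbK => /eqP.
  have vx : v t x = 0 by apply: v0.
  case/negP: (valP t); apply/eqP; apply: inj => //.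
  apply: eq_affine_fun (cell_spanning cell_P) _ aff_u _ => [|z Pz].
    exact: affine_extension_affine (cellP (val t)).
  have [||s [s_gt0 s_le1 /(_ tt) s_small]] := @small_step _ unit
      (fun=> (a i x - b i) / 2) (fun=> a i x - a i z).
  - by move=> _; rewrite divr_ge0 // subr_ge0 ltW.
  - move=> _ /eqP.
    by rewrite mulf_eq0 subr_eq0 invr_eq0 pnatr_eq0 orbF gt_eqF.
  have : v t (x + s *: (z - x)) = 0.
    apply: v0; split.
      by apply: region => //; [rewrite uE | exact: ltW].
    rewrite linearD linearZ linearB /= /GRing.scale /=.
    by move: x_i s_small; rewrite -[a i z - _]opprB mulrN; lra.
  rewrite affine_line // vx subr0 add0r => /eqP; rewrite mulf_eq0 gt_eqF //=.
  by rewrite /v subr_eq0 => /eqP.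
have [Q /cell_ex [t <-] ty] := cells_cover y hC.
have [tP|tP] := eqVneq (cell t) P.
  by move: ty; rewrite tP PE => /(_ i); rewrite leNgt ay.
have /eqP := v_y (exist _ t tP); apply.
by rewrite /v /= (affine_extensionE comp_g (cellP t)) // gy subrr.
Qed.

(** Where [g] does not bend between [P] and [Q], [k] does not bend upwards. At
    a point of [Q], this holds because the point is then in [P]. For a recession
    direction of [Q] along which the pieces of [g] have the same slope, [g] is
    affine on the rays issued from points of [P], which therefore stay in [P];
    along them [k] has the slope of its piece on [P], and lies above its piece
    on [Q]. *)
Lemma homogenize_extension_le K g k P Q w : polyhedral_complex K ->
  compatible K g -> convex_fun g -> compatible K k -> convex_fun k ->
  cells K d P -> cells K d Q ->
  (forall x, g x = affine_extension P g x -> P x) ->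
  homogenization Q w ->
  homogenize (affine_extension Q g) w = homogenize (affine_extension P g) w ->
  homogenize (affine_extension Q k) w <= homogenize (affine_extension P k) w.
Proof.
move=> hK comp_g cvx_g comp_k cvx_k cell_P cell_Q region_P Qw gE.
have aff S h := @affine_extension_affine _ _ K S h.
case: Qw => [[w_gt0 Qy]|[w0 Q_ray]].
  rewrite !homogenize_point //; do ?exact: aff.
  rewrite !homogenize_point // in gE; do ?exact: aff.
  move/(mulfI (lt0r_neq0 w_gt0)): gE.
  rewrite (affine_extensionE comp_g cell_Q) // => /region_P Py.
  rewrite (affine_extensionE comp_k cell_Q) //.
  by rewrite (affine_extensionE comp_k cell_P).
have [z Pz] := cell_neq0 cell_P; have [y Qy] := cell_neq0 cell_Q.
have P_ray s : 0 <= s -> P (z + s *: w.1).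
  move=> s_ge0; apply: region_P; apply/eqP; rewrite eq_le.
  rewrite (affine_extension_le _ hK cell_P) // andbT.
  have [S cell_S Sz] := cells_cover (z + s *: w.1) hK.
  rewrite -(affine_extensionE comp_g cell_S) // !homogenize_ray //;
    do ?exact: aff.
  rewrite (affine_extensionE comp_g cell_P) // lerD ?ler_wpM2l //.
    exact: affine_extension_le cell_S _ _.
  rewrite -gE.
  apply: (slope_le (x := affine_extension S g y) (y := g y)) => r r_ge0.
  rewrite -(affine_extensionE comp_g cell_Q Qy) -!homogenize_ray //;
    do ?exact: aff.
  rewrite (affine_extensionE comp_g cell_Q); last exact: Q_ray.
  exact: affine_extension_le cell_S _ _.
apply: (slope_le (x := affine_extension Q k z) (y := k z)) => s s_ge0.
rewrite -(affine_extensionE comp_k cell_P Pz) -!homogenize_ray //;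
  do ?exact: aff.
rewrite (affine_extensionE comp_k cell_P); last exact: P_ray.
exact: affine_extension_le cell_Q _ _.
Qed.

(** A complex [K] with the least number of cells for [g + k] also has the least
    number of cells for [g]. In the convexity tests for [K], the slacks of [k]
    vanish wherever those of [g] do, so that a small multiple of the former can
    be subtracted from the latter. *)
Lemma subtract_convex C g k : polyhedral_complex C ->
  compatible C g -> compatible C k -> convex_fun g -> convex_fun k ->
  (num_pieces (g + k)%R <= num_pieces g)%N ->
  exists2 e, 0 < e & convex_fun (- e *: k + g).
Proof.
move=> hC comp_g comp_k cvx_g cvx_k le_pieces.
have comp_gk : compatible C (g + k).
  rewrite -[g]scale1r => P CP.
  by apply: affine_onD; [apply: comp_g | apply: comp_k].
have [|[K [hK comp_Kgk nK]] _] := @num_piecesP (g + k); first by exists C.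
have comp_Kg : compatible K g.
  exact: compatible_convex_summand comp_g comp_k cvx_g cvx_k comp_Kgk.
have comp_Kk : compatible K k.
  rewrite addrC in comp_Kgk.
  exact: compatible_convex_summand comp_k comp_g cvx_k cvx_g comp_Kgk.
rewrite -nK in le_pieces.
have inj := affine_extension_inj hK comp_Kg cvx_g le_pieces.
have [I [P [Q [w [cellP cellQ Qw tests]]]]] := convex_tests hK.
pose slack h i := homogenize (affine_extension (Q i) h) (w i) -
  homogenize (affine_extension (P i) h) (w i).
have slackP h : compatible K h -> convex_fun h <-> forall i, 0 <= slack h i.
  move=> /tests ->; split=> le_h i; first by rewrite subr_ge0.
  by rewrite -subr_ge0 le_h.
have slack0 i : slack g i = 0 -> slack k i <= 0.
  move=> /eqP; rewrite subr_eq0 subr_le0 => /eqP gE.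
  apply: (homogenize_extension_le hK comp_Kg) (Qw i) gE => // x.
  exact: cell_region (cellP i).
have [|e [e_gt0 _ e_small]] := @small_step _ I (slack g) (slack k) _ slack0.
  exact: (slackP g comp_Kg).1.
exists e => //; apply/slackP.
  by move=> S KS; apply: affine_onD; [apply: comp_Kk | apply: comp_Kg].
move=> i; suff -> : slack (- e *: k + g) i = slack g i - e * slack k i.
  by rewrite subr_ge0.
rewrite /slack !(affine_extension_linear _ comp_Kk comp_Kg) // /homogenize.
by ring.
Qed.

End NumberOfPieces.

(** * The cone of classes of convex functions *)

Section ConvexCone.
Context {R : realType} {d : nat} (C : set (set 'rV[R]_d)).
Hypothesis hC : polyhedral_complex C.
Local Notation E := 'rV[R]_d.
Implicit Types (g h : cpwl_space C) (x y k : cpwl_quot C).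

Lemma cpwl_compatible g : compatible C g.
Proof. exact/asboolP/cpwl_funP. Qed.

Lemma convex_cone_class g : convex_cone C (cpwl_class g) <-> convex_fun g.
Proof.
split=> [[h cvx_h /cpwl_class_eq /asboolP aff_gh]|cvx_g]; last by exists g.
have -> : cpwl_fun g = cpwl_fun h + (-1 *: cpwl_fun (h - g)).
  have -> : cpwl_fun (h - g) = cpwl_fun h - cpwl_fun g by [].
  by rewrite scaleN1r opprB addrC subrK.
apply: convex_funD => //; apply: affine_convex_fun.
rewrite -[_ *: _]addr0; apply: affine_onD => //; exact: affine_on0.
Qed.

Lemma convex_coneD x y :
  convex_cone C x -> convex_cone C y -> convex_cone C (x + y).
Proof.
rewrite -(cpwl_reprK x) -(cpwl_reprK y) -cpwl_classD !convex_cone_class.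
exact: convex_funD.
Qed.

Lemma convex_coneZ c x : 0 <= c -> convex_cone C x -> convex_cone C (c *: x).
Proof.
move=> c_ge0; rewrite -(cpwl_reprK x) -linearZ !convex_cone_class.
exact: convex_funZ.
Qed.

(** A function that is both convex and concave is everywhere equal to each of
    its affine pieces. *)
Lemma convex_cone_pointed x : convex_cone C x -> convex_cone C (- x) -> x = 0.
Proof.
rewrite -(cpwl_reprK x); set g := cpwl_repr x.
rewrite -scaleN1r -linearZ !convex_cone_class => cvx_g cvx_Ng.
rewrite -[RHS](linear0 (@cpwl_class R d C)); apply/cpwl_class_eq/asboolP.
have [P cell_P _] := cells_cover 0 hC.
have aff_u := affine_extension_affine (cpwl_compatible g) cell_P.
rewrite subr0; congr (affine_on _ _): (aff_u); apply/funext => z; apply/eqP.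
rewrite eq_le (affine_extension_le z hC cell_P (cpwl_compatible g)) //=.
have := affine_extension_le z hC cell_P (cpwl_compatible (-1 *: g)) cvx_Ng.
pose v z : R^o := -1 * affine_extension P g z + (0 : E -> R^o) z.
have -> : affine_extension P (-1 *: g : cpwl_space C) = v.
  apply: affine_extension_unique; first exact: cell_spanning cell_P.
    by apply: affine_funD => //; apply: affine_on0.
  move=> t Pt; rewrite /v addr0.
  by rewrite (affine_extensionE (cpwl_compatible g) cell_P).
have -> : (-1 *: g : cpwl_space C) z = -1 * g z by [].
by rewrite /v addr0 !mulN1r lerN2.
Qed.

(** The convexity tests are linear and vanish on affine functions, hence they
    are defined on the quotient. *)
Lemma convex_cone_halfspaces : exists (I : finType)
  (psi : I -> {linear cpwl_quot C -> R^o}),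
  forall x, convex_cone C x <-> forall i, 0 <= psi i x.
Proof.
have [I [P [Q [w [cellP cellQ _ tests]]]]] := convex_tests hC.
pose slack (h : E -> R^o) i := homogenize (affine_extension (Q i) h) (w i) -
  homogenize (affine_extension (P i) h) (w i).
have slack_linear c g h i :
    slack (c *: g + h : cpwl_space C) i = c * slack g i + slack h i.
  have lin S := @affine_extension_linear _ _ _ S c _ _ (cpwl_compatible g)
    (cpwl_compatible h).
  by rewrite /slack !lin // /homogenize; ring.
have slack_affine g i : g \in @affine_pred R d C -> slack g i = 0.
  move=> /asboolP aff_g.
  by rewrite /slack !(affine_extension_unique (u := g)) ?subrr //;
    apply: cell_spanning (_ : cells C d _).
have slack_class g h i : cpwl_class g = cpwl_class h -> slack g i = slack h i.
  move=> /cpwl_class_eq /slack_affine gh0.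
  by rewrite -(subrK h g) -[g - h]scale1r slack_linear gh0 mulr0 add0r.
have /choice [psi psiE] : forall i, exists psi : {linear cpwl_quot C -> R^o},
    forall x, psi x = slack (cpwl_repr x) i.
  move=> i; apply: linear_funE => c x y; rewrite -slack_linear.
  by apply: slack_class; rewrite linearP /= !cpwl_reprK.
exists I, psi => x; rewrite -{1}(cpwl_reprK x) convex_cone_class.
rewrite (tests _ (cpwl_compatible _)).
by split=> le_h i; have := le_h i; rewrite psiE subr_ge0.
Qed.

Lemma class_num_pieces_le x k : convex_cone C x -> convex_cone C k ->
  (class_num_pieces x <= class_num_pieces (x + k)%R)%N.
Proof.
move=> [g cvx_g <-] [h cvx_h <-]; rewrite -cpwl_classD !class_num_piecesE.
have comp_g := cpwl_compatible g; have comp_h := cpwl_compatible h.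
have [|[K [hK comp_K <-]] _] := @num_piecesP _ _ (g + h : cpwl_space C).
  by exists C; last exact: cpwl_compatible.
have [|_] := @num_piecesP _ _ g; first by exists C.
apply=> //.
exact: compatible_convex_summand comp_g comp_h cvx_g cvx_h comp_K.
Qed.

Lemma convex_cone_subtract x k : convex_cone C x -> convex_cone C k ->
  (class_num_pieces (x + k)%R <= class_num_pieces x)%N ->
  exists2 e, 0 < e & convex_cone C (x - e *: k).
Proof.
move=> [g cvx_g <-] [h cvx_h <-].
rewrite -cpwl_classD !class_num_piecesE => le_gh.
have [e e_gt0 cvx] := subtract_convex hC (cpwl_compatible g)
  (cpwl_compatible h) cvx_g cvx_h le_gh.
exists e => //; rewrite -linearZ -linearB convex_cone_class.
by congr convex_fun : cvx; rewrite addrC scaleNr.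
Qed.

End ConvexCone.

(** * Decompositions *)

(** The second component of a decomposition is the first one minus the class of
    [f], which is unique. *)
Lemma decomp_graph (R : realType) (d : nat) (C : set (set 'rV[R]_d)) f gh :
  decomp C f gh -> exists phi : cpwl_quot C,
    decomp_proj C f = [set x | convex_cone C x /\ convex_cone C (x - phi)] /\
    forall p, decomp C f p <-> decomp_proj C f p.1 /\ p.2 = p.1 - phi.
Proof.
move=> [_ _ [f' f'E _]]; exists (cpwl_class f').
have DE p : decomp C f p <->
    (convex_cone C p.1 /\ convex_cone C (p.1 - cpwl_class f')) /\
    p.2 = p.1 - cpwl_class f'.
  case: p => x y /=; split=> [[cvx_x cvx_y [f'' f''E xyE]]|].
    have {}f''E : f'' = f' by apply: val_inj; rewrite /= f''E f'E.
    by rewrite -f''E xyE subKr.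
  by move=> [[cvx_x cvx_y] ->]; split=> //=; exists f' => //; rewrite subKr.
have projE : decomp_proj C f =
    [set x | convex_cone C x /\ convex_cone C (x - cpwl_class f')].
  apply/seteqP; split=> [x [p /DE [? _] <- //]|x Px].
  by exists (x, x - cpwl_class f') => //; apply/DE.
by rewrite projE.
Qed.

(** For a functional [psi] that defines the cone, the conditions on [x] and on
    [x - phi] amount to a lower bound on [psi x]. A vertex that minimises all of
    the [psi] thus differs from each point by an element of the cone. *)
Lemma decomp_proj_unique_vertex (R : realType) (d : nat)
    (C : set (set 'rV[R]_d)) (phi v x : cpwl_quot C) : polyhedral_complex C ->
  let P := [set x | convex_cone C x /\ convex_cone C (x - phi)] in
  unique (vertex P) v -> P x -> convex_cone C (x - v).
Proof.
move=> hC P v_uniq Px; have [I [psi coneE]] := convex_cone_halfspaces hC.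
have pointed y : (forall i, psi i y = 0) -> y = 0.
  move=> y0; apply: (convex_cone_pointed hC); apply/coneE => i.
    by rewrite y0.
  by rewrite linearN y0 oppr0.
pose beta i := Num.max 0 (psi i phi).
have PE : P = [set y | forall i, beta i <= psi i y].
  apply/seteqP; split=> [y [/coneE y_ge0 /coneE yphi_ge0] i|y /= y_ge].
    by rewrite ge_max y_ge0 -subr_ge0 -linearB yphi_ge0.
  split; apply/coneE => i; have := y_ge i; rewrite ge_max => /andP [y0 yphi] //.
  by rewrite linearB subr_ge0.
apply/coneE => i; rewrite linearB subr_ge0.
by apply: (unique_vertex_le (beta := beta)) => //; rewrite -PE.
Qed.

Theorem proposition4p13 (R : realType) (d : nat) (f : 'rV[R]_d -> R^o)
    (C : set (set 'rV[R]_d)) (hf : cpwl f) (hC : polyhedral_complex C) :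
  (forall gh : cpwl_quot C * cpwl_quot C, decomp C f gh ->
    (unique (vertex (decomp C f)) gh <->
     unique (vertex (decomp_proj C f)) gh.1)) /\
  (forall gh : cpwl_quot C * cpwl_quot C,
    unique (vertex (decomp C f)) gh -> unique (minimal_decomp C f) gh).
Proof.
have unique_proj gh : decomp C f gh -> (unique (vertex (decomp C f)) gh <->
    unique (vertex (decomp_proj C f)) gh.1).
  move=> D_gh; have [phi [_ DE]] := decomp_graph D_gh.
  have vertexE := vertex_graph DE; have [_ ghE] := (DE gh).1 D_gh.
  split=> [[/vertexE [v_gh _] uniq]|[v_gh uniq]].
    split=> // x v_x; have /(congr1 fst) // : gh = (x, x - phi).
    by apply: uniq; apply/vertexE.
  split=> [|[x y] /vertexE /= [v_x ->]]; first by apply/vertexE.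
  by rewrite -(uniq x v_x) -ghE; case: (gh).
split=> // gh uniq_gh; have D_gh := vertex_mem uniq_gh.1.
have uniq_g := (unique_proj gh D_gh).1 uniq_gh.
have [phi [projE DE]] := decomp_graph D_gh.
case: gh D_gh {uniq_gh} uniq_g => g h D_gh /= uniq_g.
have [_ /= hE] := (DE _).1 D_gh; have [cvx_g cvx_h _] := D_gh.
have shift g' h' : decomp C f (g', h') ->
    exists k, [/\ convex_cone C k, g' = g + k & h' = h + k].
  move=> /DE /= [proj_g' ->]; exists (g' - g); split.
  - by apply: (decomp_proj_unique_vertex (phi := phi)); rewrite -?projE.
  - by rewrite addrC subrK.
  - by rewrite hE addrAC [g + _]addrC subrK.
split.
  split=> // -[[g' h'] [/= D' _ _ _]].
  have [k [cvx_k -> ->]] := shift _ _ D'.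
  by case; rewrite ltnNge class_num_pieces_le.
move=> [g' h'] [D' min_gh']; have [k [cvx_k g'E h'E]] := shift _ _ D'.
have le_g : (class_num_pieces g <= class_num_pieces g')%N.
  by rewrite g'E class_num_pieces_le.
have le_h : (class_num_pieces h <= class_num_pieces h')%N.
  by rewrite h'E class_num_pieces_le.
apply: contrapT => gh_neq.
have nlt : ~ ((class_num_pieces g < class_num_pieces g')%N \/
              (class_num_pieces h < class_num_pieces h')%N).
  by move=> lt_gh; apply: min_gh'; exists (g, h).
have [e1 e1_gt0 cvx_e1] : exists2 e, 0 < e & convex_cone C (g - e *: k).
  apply: convex_cone_subtract => //; rewrite -g'E leqNgt; apply/negP => lt_g.
  by apply: nlt; left.
have [e2 e2_gt0 cvx_e2] : exists2 e, 0 < e & convex_cone C (h - e *: k).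
  apply: convex_cone_subtract => //; rewrite -h'E leqNgt; apply/negP => lt_h.
  by apply: nlt; right.
pose e := Num.min e1 e2.
have cvx_e x e' :
    e <= e' -> convex_cone C (x - e' *: k) -> convex_cone C (x - e *: k).
  move=> le_e cvx_x; have -> : x - e *: k = x - e' *: k + (e' - e) *: k.
    by rewrite scalerBl addrA subrK.
  by apply: convex_coneD => //; apply: convex_coneZ => //; rewrite subr_ge0.
have D_e : decomp C f (g - e *: k, h - e *: k).
  apply/DE; rewrite projE /= hE addrAC; split=> //; split.
    by apply: cvx_e cvx_e1; rewrite ge_min lexx.
  by rewrite -hE; apply: cvx_e cvx_e2; rewrite ge_min lexx orbT.
have [k' [cvx_k' k'E _]] := shift _ _ D_e.
have k0 : k = 0.
  apply: (convex_cone_pointed hC) => //.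
  have e_gt0 : 0 < e by rewrite lt_min e1_gt0.
  have -> : - k = e^-1 *: k'.
    by rewrite -(addrI _ k'E) scalerN scalerA mulVf ?gt_eqF // scale1r.
  by apply: convex_coneZ => //; rewrite invr_ge0 ltW.
by apply: gh_neq; rewrite g'E h'E k0 !addr0.
Qed.
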